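(* Let $\mu\ge 0$ be a Radon measure on $\mathbb{R}^n$ and let $(\mathcal V,\bar\nabla)$ be a $G$-structure on $(\mathbb{R}^n,d_{\rm Eucl},\mu)$. Then $$W^{1,2}(\mathbb{R}^n,\mu)=\{f\in L^2(\mu)\;|\;G(f)\neq\emptyset\}.$$ Moreover, for every $f\in W^{1,2}(\mathbb{R}^n,\mu)$, the minimal weak upper gradient $|D_\mu f|$ coincides $\mu$-a.e. with the pointwise norm of the minimal $G$-gradient of $f$.
   Context: Test plans. $d_{\rm Eucl}(x,y)=|x-y|$; $C([0,1],\mathbb{R}^n)$ has the supremum distance; $e_t(\gamma)=\gamma_t$; $AC^2([0,1],\mathbb{R}^n)$ is the set of absolutely continuous curves $\gamma$ with $\int_0^1|\dot\gamma_t|^2\,dt<\infty$. A test plan on $(\mathbb{R}^n,d_{\rm Eucl},\mu)$ is a Borel probability measure $\pi$ on $C([0,1],\mathbb{R}^n)$, concentrated on $AC^2([0,1],\mathbb{R}^n)$, with $\int\int_0^1|\dot\gamma_t|^2\,dt\,d\pi(\gamma)<\infty$ and $(e_t)_*\pi\le C\mu$ for all $t\in[0,1]$, for some constant $C>0$. Sobolev space. A nonnegative $G\in L^2(\mu)$ is a weak upper gradient of $f\in L^2(\mu)$ if for every test plan $\pi$, for $\pi$-a.e. $\gamma$ one has $f\circ\gamma\in W^{1,1}(0,1)$ and $|(f\circ\gamma)'_t|\le G(\gamma_t)|\dot\gamma_t|$ for a.e. $t\in[0,1]$. $W^{1,2}(\mathbb{R}^n,\mu)$ is the set of $f\in L^2(\mu)$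 having a weak upper gradient; $|D_\mu f|$ is the $\mu$-a.e. minimal one. The Cheeger energy ${\rm E}_{\rm Ch}:L^2(\mu)\to[0,+\infty]$ is $\frac12\int|D_\mu f|^2\,d\mu$ on $W^{1,2}(\mathbb{R}^n,\mu)$ and $+\infty$ otherwise. The lower semicontinuous envelope of ${\rm E}:L^2(\mu)\to[0,+\infty]$ is $\tilde{\rm E}(f)=\inf\liminf_i{\rm E}(f_i)$, the infimum being over sequences $f_i\to f$ in $L^2(\mu)$. $G$-structure. A $G$-structure on $(\mathbb{R}^n,d_{\rm Eucl},\mu)$ is a couple $(\mathcal V,\bar\nabla)$ such that: (A1) $\mathcal V$ is a linear subspace of $W^{1,2}(\mathbb{R}^n,\mu)$ containing $C^\infty_c(\mathbb{R}^n)$; (A2) $\bar\nabla:\mathcal V\to L^2(\mathbb{R}^n,\mathbb{R}^n;\mu)$ is linear; (A3) $|\bar\nabla f|$ is a weak upper gradient of $f$ for every $f\in\mathcal V$, and $|\bar\nabla f|\in L^\infty(\mu)$ if $f\in C^\infty_c(\mathbb{R}^n)$; (A4) if $f\in\mathcal V$ and $g\in C^\infty_c(\mathbb{R}^n)$, then $fg\in\mathcal V$ and $\bar\nabla(fg)=f\bar\nabla g+g\bar\nabla f$ $\mu$-a.e.; (A5) ${\rm E}_{\rm Ch}$ is the lower semicontinuous envelope of the functional ${\rm E}_G:L^2(\mu)\to[0,+\infty]$ equal to $\frac12\int|\bar\nabla f|^2\,d\mu$ if $f\in\mathcal V$ and $+\infty$ otherwise. $G$-gradients. Given $f\in L^2(\mu)$,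 a vector field $\underline v\in L^2(\mathbb{R}^n,\mathbb{R}^n;\mu)$ is a $G$-gradient of $f$ if there is $(f_i)_i\subseteq\mathcal V$ with $f_i\to f$ strongly in $L^2(\mu)$ and $\bar\nabla f_i\to\underline v$ strongly in $L^2(\mathbb{R}^n,\mathbb{R}^n;\mu)$. $G(f)$ is the (closed, affine) set of all $G$-gradients of $f$, and, when $G(f)\ne\emptyset$, its unique element of minimal $L^2(\mathbb{R}^n,\mathbb{R}^n;\mu)$-norm is the minimal $G$-gradient of $f$. *)

(* Defs.v *)
From HB Require Import structures.
From mathcomp Require Import all_boot all_order all_algebra.
From mathcomp Require Import all_classical all_reals all_analysis.

Set Implicit Arguments.
Unset Strict Implicit.
Unset Printing Implicit Defensive.

Import Order.TTheory GRing.Theory Num.Theory.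
Import numFieldNormedType.Exports.

Local Open Scope classical_set_scope.
Local Open Scope ring_scope.

(** The library norm on ['rV[R]_n] is the sup norm, whence this definition.
    Both norms induce the same topology. *)
Definition enorm (R : realType) (n : nat) (x : 'rV[R]_n) : R :=
  Num.sqrt (\sum_(i < n) x 0 i ^+ 2).

(** R^n with its Borel sigma-algebra *)
Notation borelRn R n := (g_sigma_algebraType (@open 'rV[R]_n)).

Definition radon (R : realType) (n : nat)
    (mu : {measure set (borelRn R n) -> \bar R}) : Prop :=
  (forall K : set 'rV[R]_n, compact K -> (mu K < +oo)%E) /\
  (forall A : set (borelRn R n), measurable A ->
     mu A = ereal_sup [set mu K | K in
       [set K : set 'rV[R]_n | compact K /\ K `<=` A]]).

Fixpoint classC (R : realType) (V : normedModType R) (k : nat) (f : V -> R) :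
    Prop :=
  match k with
  | 0 => continuous f
  | k'.+1 => (forall v x, derivable f x v) /\ (forall v, classC k' ('D_v f))
  end.

Definition smooth (R : realType) (V : normedModType R) (f : V -> R) : Prop :=
  forall k, classC k f.

Definition tsupp (R : realType) (V : normedModType R) (f : V -> R) : set V :=
  closure [set x | f x != 0].

Definition Ccinfty (R : realType) (V : normedModType R) (f : V -> R) : Prop :=
  smooth f /\ compact (tsupp f).

(** An element of C([0,1], R^n) is represented by its unique extension to the
    real line that is constant on ]-oo, 0] and on [1, +oo[. *)
Record curve (R : realType) (n : nat) := Curve {
  curve_fun :> R -> 'rV[R]_n;
  _ : {within `[0, 1], continuous curve_fun};
  _ : forall t, t <= 0 -> curve_fun t = curve_fun 0;
  _ : forall t, 1 <= t -> curve_fun t = curve_fun 1 }.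

HB.instance Definition _ (R : realType) (n : nat) := gen_eqMixin (curve R n).
HB.instance Definition _ (R : realType) (n : nat) :=
  gen_choiceMixin (curve R n).

Definition curve0 (R : realType) (n : nat) : curve R n :=
  @Curve R n (cst 0) (fun=> cvg_cst _) (fun _ _ => erefl) (fun _ _ => erefl).

HB.instance Definition _ (R : realType) (n : nat) :=
  isPointed.Build (curve R n) (@curve0 R n).

Definition curve_dist (R : realType) (n : nat) (g h : curve R n) : R :=
  sup [set enorm (g t - h t) | t in `[0, 1]].

Definition curve_open (R : realType) (n : nat) : set (set (curve R n)) :=
  [set A | forall g, A g ->
     exists2 e : R, 0 < e & forall h, curve_dist g h < e -> A h].

(** C([0,1], R^n) with the Borel sigma-algebra of the supremum distance *)
Notation borelC R n := (g_sigma_algebraType (@curve_open R n)).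

Definition evalC (R : realType) (n : nat) (t : R) (g : borelC R n) :
  borelRn R n := curve_fun g t.

Definition speed (R : realType) (n : nat) (g : curve R n) (t : R) : R :=
  enorm (derive1 (g : R -> 'rV[R]_n) t).

Definition kinetic (R : realType) (n : nat) (g : curve R n) : \bar R :=
  (\int[@lebesgue_measure R]_(t in `[0%R, 1%R]) ((speed g t) ^+ 2)%:E)%E.

Definition abs_continuous (R : realType) (n : nat) (g : curve R n) : Prop :=
  forall e : R, 0 < e -> exists2 d : R, 0 < d &
  forall (m : nat) (a b : 'I_m -> R),
    (forall i, [/\ 0 <= a i, a i <= b i & b i <= 1]) ->
    (forall i j, i != j -> b i <= a j \/ b j <= a i) ->
    \sum_(i < m) (b i - a i) < d ->
    \sum_(i < m) enorm (g (b i) - g (a i)) < e.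

Definition AC2 (R : realType) (n : nat) (g : curve R n) : Prop :=
  abs_continuous g /\ (kinetic g < +oo)%E.

Definition test_plan (R : realType) (n : nat)
    (mu : {measure set (borelRn R n) -> \bar R})
    (pi : probability (borelC R n) R) : Prop :=
  [/\ {ae pi, forall g, AC2 g},
      (\int[pi]_g kinetic g < +oo)%E &
      exists2 C : R, 0 < C & forall t : R, 0 <= t <= 1 ->
        forall A : set (borelRn R n), measurable A ->
          (pushforward pi (@evalC R n t) A <= C%:E * mu A)%E].

(** [u] belongs to W^{1,1}(0,1) and [u'] is (a representative of) its
    distributional derivative. *)
Definition W11_derivative (R : realType) (u u' : R -> R) : Prop :=
  [/\ (@lebesgue_measure R).-integrable `]0, 1[ (EFin \o u),
      (@lebesgue_measure R).-integrable `]0, 1[ (EFin \o u') &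
      forall phi : R -> R, Ccinfty phi -> tsupp phi `<=` `]0, 1[ ->
        \int[@lebesgue_measure R]_(t in `]0, 1[) (u t * derive1 phi t) =
        - \int[@lebesgue_measure R]_(t in `]0, 1[) (u' t * phi t)].

Section Sobolev.
Context (R : realType) (n : nat).
Context (mu : {measure set (borelRn R n) -> \bar R}).

(** Elements of L^2(mu) are handled through Borel representatives
    [f \in Lfun mu 2]; all the notions below only depend on the mu-a.e.
    equivalence classes. *)

Definition normL2 (f : 'rV[R]_n -> R) : \bar R :=
  ('N[mu]_2%:E[EFin \o f])%E.

Definition cvgL2 (f_ : nat -> 'rV[R]_n -> R) (f : 'rV[R]_n -> R) : Prop :=
  normL2 (fun x => f_ i x - f x) @[i --> \oo] --> 0%E.

Definition L2vec (v : 'rV[R]_n -> 'rV[R]_n) : Prop :=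
  forall i : 'I_n, (fun x => v x 0 i) \in Lfun mu 2%:E.

Definition normL2vec (v : 'rV[R]_n -> 'rV[R]_n) : \bar R :=
  normL2 (fun x => enorm (v x)).

Definition cvgL2vec (v_ : nat -> 'rV[R]_n -> 'rV[R]_n)
    (v : 'rV[R]_n -> 'rV[R]_n) : Prop :=
  normL2vec (fun x => v_ i x - v x) @[i --> \oo] --> 0%E.

Definition is_wug (f G : 'rV[R]_n -> R) : Prop :=
  [/\ f \in Lfun mu 2%:E, G \in Lfun mu 2%:E,
      {ae mu, forall x, 0 <= G x} &
      forall pi : probability (borelC R n) R, test_plan mu pi ->
        {ae pi, forall g : curve R n,
          exists2 u' : R -> R, W11_derivative (f \o g) u' &
          {ae @lebesgue_measure R, forall t, 0 <= t <= 1 ->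
             `|u' t| <= G (g t) * speed g t}}].

Definition W12 : set ('rV[R]_n -> R) :=
  [set f | f \in Lfun mu 2%:E /\ exists G, is_wug f G].

Definition is_min_wug (f G : 'rV[R]_n -> R) : Prop :=
  is_wug f G /\ forall H, is_wug f H -> {ae mu, forall x, G x <= H x}.

(** A representative of |D_mu f|; it is unique up to mu-a.e. equality, and the
    default value is irrelevant for f in W^{1,2}. *)
Definition min_wug (f : 'rV[R]_n -> R) : 'rV[R]_n -> R :=
  xget (cst 0) [set G | is_min_wug f G].

Definition cheeger (f : 'rV[R]_n -> R) : \bar R :=
  if `[< W12 f >] then
    ((2^-1)%:E * \int[mu]_x ((min_wug f x) ^+ 2)%:E)%E
  else +oo%E.

Definition lsc_envelope (E : ('rV[R]_n -> R) -> \bar R) (f : 'rV[R]_n -> R) :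
    \bar R :=
  ereal_inf [set limn_einf (E \o f_) | f_ in
    [set f_ : nat -> 'rV[R]_n -> R |
       (forall i, f_ i \in Lfun mu 2%:E) /\ cvgL2 f_ f]].

Section Gstructure.
Context (V : set ('rV[R]_n -> R)).
Context (nabla : ('rV[R]_n -> R) -> 'rV[R]_n -> 'rV[R]_n).

Definition energyG (f : 'rV[R]_n -> R) : \bar R :=
  if `[< V f >] then
    ((2^-1)%:E * \int[mu]_x ((enorm (nabla f x)) ^+ 2)%:E)%E
  else +oo%E.

(** The fields [GS_V_ae] and [GS_nabla_ae] say that [V] is a set of
    equivalence classes and that [nabla] is well defined on them; [nabla] is
    unconstrained outside [V]. *)
Record G_structure : Prop := {
  GS_V_ae : forall f f', V f -> f' \in Lfun mu 2%:E ->
    {ae mu, forall x, f x = f' x} -> V f';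
  GS_V_W12 : V `<=` W12;
  GS_V_lin : forall (a : R) f g, V f -> V g -> V (fun x => a * f x + g x);
  GS_V_Cc : forall f, Ccinfty f -> V f;
  GS_nabla_L2 : forall f, V f -> L2vec (nabla f);
  GS_nabla_ae : forall f f', V f -> V f' -> {ae mu, forall x, f x = f' x} ->
    {ae mu, forall x, nabla f x = nabla f' x};
  GS_nabla_lin : forall (a : R) f g, V f -> V g ->
    {ae mu, forall x,
       nabla (fun y => a * f y + g y) x = a *: nabla f x + nabla g x};
  GS_wug : forall f, V f -> is_wug f (fun x => enorm (nabla f x));
  GS_bounded : forall f, Ccinfty f ->
    ('N[mu]_+oo[EFin \o (fun x => enorm (nabla f x))] < +oo)%E;
  GS_leibniz : forall f g, V f -> Ccinfty g ->
    V (fun x => f x * g x) /\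
    {ae mu, forall x,
       nabla (fun y => f y * g y) x = f x *: nabla g x + g x *: nabla f x};
  GS_envelope : forall f, f \in Lfun mu 2%:E ->
    cheeger f = lsc_envelope energyG f }.

Definition Ggradients (f : 'rV[R]_n -> R) : set ('rV[R]_n -> 'rV[R]_n) :=
  [set v | L2vec v /\ exists f_ : nat -> 'rV[R]_n -> R,
     [/\ forall i, V (f_ i), cvgL2 f_ f & cvgL2vec (fun i => nabla (f_ i)) v]].

Definition is_min_Ggradient (f : 'rV[R]_n -> R) (v : 'rV[R]_n -> 'rV[R]_n) :
    Prop :=
  Ggradients f v /\
  forall w, Ggradients f w -> (normL2vec v <= normL2vec w)%E.

End Gstructure.
End Sobolev.

(* Main.v *)
Require Import Defs.
From mathcomp Require Import all_boot all_order all_algebra.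
From mathcomp Require Import all_classical all_reals all_analysis.
From mathcomp Require Import measurable_realfun ring lra.

Set Implicit Arguments.
Unset Strict Implicit.
Unset Printing Implicit Defensive.

Import Order.TTheory GRing.Theory Num.Theory.
Import numFieldNormedType.Exports.

Local Open Scope classical_set_scope.
Local Open Scope ring_scope.

(** The energy of G-gradients and the Cheeger energy are two descriptions of
    one relaxed functional, and the theorem compares them in both directions.

    From finite Cheeger energy to a G-gradient.  By the envelope axiom, f is
    approximated in L^2 by elements h of V whose energies stay bounded.  On
    the set of those h in V within distance 1/(k+1) of f, choose one whose
    energy is minimal up to 1/(k+1).  These sets decrease and are stable under
    midpoints, so the parallelogram identity turns almost minimality into the
    Cauchy property of the gradients ([almost_minimizers_cauchy]): no weak
    compactness is involved.  The limit v of the gradients is a G-gradient of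
    f, and its energy does not exceed the relaxed energy ([exists_Ggradient]),
    while every G-gradient has at least that energy
    ([envelope_le_Ggradient]).  Hence v is minimal and its energy is exactly
    the Cheeger energy of f.

    From a G-gradient to a weak upper gradient.  The norm of a G-gradient of f
    is a weak upper gradient of f ([wug_Ggradient]), because weak upper
    gradients are stable under L^2 convergence ([is_wug_limit]).  By the bound
    on the time marginals of a test plan and Tonelli's theorem, L^2(mu)
    convergence becomes, along a subsequence, L^2(0,1) convergence along
    almost every curve.  On one curve, write the weak derivatives as products
    q_i s, where s is a measurable function below the speed and the q_i are
    dominated by the upper gradients: the q_i are bounded in L^2(0,1), and the
    same midpoint argument replaces them by a strongly convergent sequence,
    with a limit q such that q s is the weak derivative of the limit function
    ([weak_derivative_limit]).

    Conclusion.  If G is the minimal weak upper gradient and v a minimal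
    G-gradient of f, then G <= |v| by the second point, and both have the same
    L^2 norm by the first one, so they agree almost everywhere.  The existence
    of G also comes for free: a function of W^{1,2} without a minimal weak
    upper gradient would have zero Cheeger energy, the default value of [min_wug] being 0, so
    its G-gradient v would vanish and |v| would be a minimal weak upper
    gradient. *)

(** * The quadratic functional *)
Lemma cvg0_eP (R : realType) (u : nat -> \bar R) : (forall i, 0 <= u i)%E ->
  (u i @[i --> \oo] --> 0%E) <->
  (forall e : R, 0 < e -> exists K, forall i, (K <= i)%N -> (u i <= e%:E)%E).
Proof.
move=> u0; split.
- move=> /fine_cvgP [ufin uc] e e0.
  have : \forall i \near \oo, (u i <= e%:E)%E.
    move/cvgrPdist_le : uc => /(_ e e0) uc.
    near=> i.
    have ui : u i \is a fin_num by near: i.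
    rewrite -(fineK ui) lee_fin.
    have : `|0 - fine (u i)| <= e by near: i.
    by rewrite sub0r normrN ger0_norm// fine_ge0.
  by move=> [K _ HK]; exists K => i Ki; exact: HK.
- move=> H; apply/fine_cvgP; split.
    have [K HK] := H 1 ltr01.
    exists K => // i /= Ki; rewrite ge0_fin_numE//.
    by rewrite (le_lt_trans (HK _ Ki))// ltry.
  apply/cvgrPdist_le => e e0; have [K HK] := H e e0.
  exists K => // i /= Ki.
  rewrite sub0r normrN ger0_norm ?fine_ge0//.
  rewrite -lee_fin fineK ?HK// ge0_fin_numE//.
  by rewrite (le_lt_trans (HK _ Ki))// ltry.
Unshelve. all: by end_near. Qed.

Section sqnorm.
Context d (T : measurableType d) (R : realType).
Variable mu : {measure set T -> \bar R}.
Variable D : set T.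
Hypothesis mD : measurable D.
Implicit Types f g : T -> R.

Definition sqnorm (f : T -> R) : \bar R := (\int[mu]_(x in D) (f x ^+ 2)%:E)%E.

Lemma sqnorm_ge0 f : (0 <= sqnorm f)%E.
Proof. by apply: integral_ge0 => x _; rewrite lee_fin sqr_ge0. Qed.

Lemma measurable_sqr f : measurable_fun D f ->
  measurable_fun D (EFin \o (fun x => f x ^+ 2)).
Proof. by move=> mf; apply/measurable_EFinP; exact: measurable_funX. Qed.

Lemma le_sqnorm_ae f g : measurable_fun D f -> measurable_fun D g ->
  {ae mu, forall x, D x -> `|f x| <= `|g x|} -> (sqnorm f <= sqnorm g)%E.
Proof.
move=> mf mg fg; apply: ae_ge0_le_integral => //.
- by move=> x _; rewrite lee_fin sqr_ge0.
- exact: measurable_sqr.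
- by move=> x _; rewrite lee_fin sqr_ge0.
- exact: measurable_sqr.
apply: filterS fg => x fg Dx; rewrite lee_fin -[leLHS]ger0_norm ?sqr_ge0//.
by rewrite -[leRHS]ger0_norm ?sqr_ge0// !normrX ler_sqr ?nnegrE// fg.
Qed.

Lemma le_sqnorm f g : measurable_fun D f -> measurable_fun D g ->
  (forall x, D x -> `|f x| <= `|g x|) -> (sqnorm f <= sqnorm g)%E.
Proof. by move=> mf mg fg; apply: le_sqnorm_ae => //; exact: aeW. Qed.

Lemma eq_sqnorm f g : (forall x, D x -> f x ^+ 2 = g x ^+ 2) ->
  sqnorm f = sqnorm g.
Proof. by move=> fg; apply: eq_integral => x; rewrite inE => Dx; rewrite fg. Qed.

Lemma eq_sqnorm_ae f g : measurable_fun D f -> measurable_fun D g ->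
  {ae mu, forall x, D x -> f x = g x} -> sqnorm f = sqnorm g.
Proof.
by move=> mf mg fg; apply/eqP; rewrite eq_le !le_sqnorm_ae//;
  apply: filterS fg => x fg Dx; rewrite fg.
Qed.

Lemma sqnormB f g : sqnorm (fun x => f x - g x)%R = sqnorm (fun x => g x - f x).
Proof. by apply: eq_sqnorm => x _; ring. Qed.

Lemma sqnormZ (a : R) f : measurable_fun D f ->
  sqnorm (fun x => a * f x) = ((a ^+ 2)%:E * sqnorm f)%E.
Proof.
move=> mf; rewrite /sqnorm -ge0_integralZl_EFin ?sqr_ge0//.
- by apply: eq_integral => x _; rewrite exprMn EFinM.
- by move=> x _; rewrite lee_fin sqr_ge0.
- exact: measurable_sqr.
Qed.

Lemma sqnorm_parallelogram f g : measurable_fun D f -> measurable_fun D g ->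
  (sqnorm (fun x => f x + g x)%R + sqnorm (fun x => f x - g x)%R =
   2%:E * sqnorm f + 2%:E * sqnorm g)%E.
Proof.
move=> mf mg; rewrite /sqnorm.
have mfD := measurable_funD mf mg; have mfB := measurable_funB mf mg.
rewrite -!ge0_integralZl_EFin//; last first.
- exact: measurable_sqr.
- by move=> x _; rewrite lee_fin sqr_ge0.
- exact: measurable_sqr.
- by move=> x _; rewrite lee_fin sqr_ge0.
rewrite -!ge0_integralD//.
- by apply: eq_integral => x _; rewrite -!EFinM -!EFinD; congr EFin; ring.
- by move=> x _; rewrite -EFinM lee_fin mulr_ge0 ?sqr_ge0.
- by apply/measurable_EFinP; apply: measurable_funM => //; exact: measurable_funX.
- by move=> x _; rewrite -EFinM lee_fin mulr_ge0 ?sqr_ge0.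
- by apply/measurable_EFinP; apply: measurable_funM => //; exact: measurable_funX.
- by move=> x _; rewrite lee_fin sqr_ge0.
- exact: measurable_sqr.
- by move=> x _; rewrite lee_fin sqr_ge0.
- exact: measurable_sqr.
Qed.

Lemma sqnormD_le f g : measurable_fun D f -> measurable_fun D g ->
  (sqnorm (fun x => f x + g x)%R <= 2%:E * sqnorm f + 2%:E * sqnorm g)%E.
Proof.
by move=> mf mg; rewrite -sqnorm_parallelogram// leeDl// sqnorm_ge0.
Qed.

(** Convexity of the squared norm, in the midpoint form that makes balls of
    L^2 stable under midpoints. *)
Lemma sqnorm_mid f g : measurable_fun D f -> measurable_fun D g ->
  (sqnorm (fun x => 2^-1 * (f x + g x))%R <=
   2^-1%:E * (sqnorm f + sqnorm g))%E.
Proof.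
move=> mf mg; rewrite sqnormZ; last exact: measurable_funD.
have := sqnormD_le mf mg; rewrite -ge0_muleDr ?sqnorm_ge0// => H.
have -> : ((2^-1 ^+ 2)%:E = (2^-1)%:E * (2^-1)%:E :> \bar R)%E.
  by rewrite -EFinM expr2.
rewrite -muleA lee_pmul2l// ?lte_fin ?invr_gt0// muleC lee_pdivrMr//.
by rewrite muleC.
Qed.

(** Young's inequality with a free weight [e]; letting the weight depend on
    the second factor gives the continuity of the pairing below and avoids
    square roots in extended reals. *)
Lemma integral_cross_le f g (e : R) : 0 < e ->
  measurable_fun D f -> measurable_fun D g ->
  (\int[mu]_(x in D) `|f x * g x|%:E <= e%:E * sqnorm g + e^-1%:E * sqnorm f)%E.
Proof.
move=> e0 mf mg; have ei0 : 0 < e^-1 by rewrite invr_gt0.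
rewrite /sqnorm -!ge0_integralZl_EFin ?(ltW e0) ?(ltW ei0)//; last first.
- exact: measurable_sqr.
- by move=> x _; rewrite lee_fin sqr_ge0.
- exact: measurable_sqr.
- by move=> x _; rewrite lee_fin sqr_ge0.
have me (h : T -> R) (c : R) : measurable_fun D h ->
    measurable_fun D (EFin \o (fun x => c * h x ^+ 2)).
  move=> mh; apply/measurable_EFinP; apply: measurable_funM => //.
  exact: measurable_funX.
have h0 (h : T -> R) (c : R) : 0 < c ->
    forall x, D x -> (0 <= c%:E * (h x ^+ 2)%:E)%E.
  by move=> c0 x _; rewrite -EFinM lee_fin mulr_ge0 ?sqr_ge0 ?ltW.
rewrite -ge0_integralD//; try by [exact: me | exact: h0].
apply: ge0_le_integral => //.
- apply/measurable_EFinP; apply: measurableT_comp => //.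
  exact: measurable_funM.
- by apply: emeasurable_funD; exact: me.
move=> x _; rewrite -!EFinM -EFinD lee_fin normrM.
rewrite -(real_normK (num_real (f x))) -(real_normK (num_real (g x))).
set a := `|f x|; set b := `|g x|.
have a0 : 0 <= a := normr_ge0 _. have b0 : 0 <= b := normr_ge0 _.
rewrite -subr_ge0.
have -> : e * b ^+ 2 + e^-1 * a ^+ 2 - a * b =
  e^-1 * (a - e * b) ^+ 2 + a * b by field; rewrite gt_eqF.
by apply: addr_ge0; apply: mulr_ge0 => //; [exact: ltW|exact: sqr_ge0].
Qed.

Lemma cvg_integral_cross (f_ : nat -> T -> R) g :
  (forall i, measurable_fun D (f_ i)) -> measurable_fun D g ->
  (sqnorm g < +oo)%E -> sqnorm (f_ i) @[i --> \oo] --> 0%E ->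
  (\int[mu]_(x in D) `|f_ i x * g x|%:E)%E @[i --> \oo] --> 0%E.
Proof.
move=> mf mg goo /cvg0_eP f0; apply/cvg0_eP.
  by move=> i; apply: integral_ge0 => x _; rewrite lee_fin.
move=> e e0.
have gfin : sqnorm g \is a fin_num by rewrite ge0_fin_numE ?sqnorm_ge0.
set G := fine (sqnorm g); have G0 : 0 <= G by rewrite fine_ge0// sqnorm_ge0.
pose c := e / 2 / (G + 1).
have G1 : 0 < G + 1 by rewrite ltr_wpDl.
have c0 : 0 < c by rewrite !divr_gt0.
have [|K HK] := f0 (fun i => sqnorm_ge0 (f_ i)) (c * (e / 2)).
  by rewrite mulr_gt0 ?divr_gt0.
exists K => i Ki.
apply: (le_trans (integral_cross_le c0 (mf i) mg)).
rewrite -(fineK gfin) -/G [leRHS](_ : _ = (e / 2)%:E + (e / 2)%:E)%E; last first.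
  by rewrite -EFinD -splitr.
apply: leeD.
  rewrite -EFinM lee_fin -[leRHS](@divfK _ (G + 1)) ?gt_eqF// -/c.
  by rewrite ler_wpM2l ?(ltW c0)// lerDl.
apply: (@le_trans _ _ (c^-1%:E * (c * (e / 2))%:E)%E).
  by rewrite lee_pmul2l ?HK// ?lte_fin ?invr_gt0.
by rewrite -EFinM mulKf ?gt_eqF.
Qed.

End sqnorm.

Section integrable_product.
Context d (T : measurableType d) (R : realType).
Variable mu : {measure set T -> \bar R}.
Variable D : set T.
Hypothesis mD : measurable D.

Lemma integrable_mul (f g : T -> R) : measurable_fun D f -> measurable_fun D g ->
  (sqnorm mu D f < +oo)%E -> (sqnorm mu D g < +oo)%E ->
  mu.-integrable D (EFin \o (fun x => f x * g x)).
Proof.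
move=> mf mg foo goo; apply/integrableP; split.
  by apply/measurable_EFinP; exact: measurable_funM.
apply: (le_lt_trans (integral_cross_le mu mD ltr01 mf mg)).
by rewrite invr1 !mul1e lte_add_pinfty.
Qed.

Lemma sqnormB_lty (f g : T -> R) : measurable_fun D f -> measurable_fun D g ->
  (sqnorm mu D f < +oo)%E -> (sqnorm mu D g < +oo)%E ->
  (sqnorm mu D (fun x => f x - g x)%R < +oo)%E.
Proof.
move=> mf mg foo goo.
apply: (@le_lt_trans _ _ (2%:E * sqnorm mu D f + 2%:E * sqnorm mu D g)%E).
  by rewrite -sqnorm_parallelogram// leeDr// sqnorm_ge0.
by rewrite lte_add_pinfty// lte_mul_pinfty.
Qed.

Lemma sqnorm_lty_limit (f g : T -> R) : measurable_fun D f -> measurable_fun D g ->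
  (sqnorm mu D g < +oo)%E -> (sqnorm mu D (fun x => f x - g x)%R < +oo)%E ->
  (sqnorm mu D f < +oo)%E.
Proof.
move=> mf mg goo dfoo.
have mfg : measurable_fun D (fun x => f x - g x) by exact: measurable_funB.
have -> : f = (fun x => (f x - g x) + g x) by apply/funext => x; rewrite subrK.
apply: (le_lt_trans (sqnormD_le mu mD mfg mg)).
by rewrite lte_add_pinfty// lte_mul_pinfty.
Qed.

End integrable_product.

(** * Completeness of the quadratic functional *)
Lemma limn_einfE (R : realType) (u : nat -> \bar R) :
  limn_einf u = ereal_sup (range (einfs u)).
Proof. by rewrite limn_einf_lim; apply/cvg_lim => //; exact: cvg_einfs_sup. Qed.

Lemma limn_einf_le (R : realType) (u : nat -> \bar R) (a : \bar R) K :
  (forall i, (K <= i)%N -> (u i <= a)%E) -> (limn_einf u <= a)%E.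
Proof.
move=> uK; rewrite limn_einfE; apply: ge_ereal_sup => _ [n _ <-].
apply: (le_trans _ (uK _ (leq_maxr n K))); apply: ereal_inf_lbound.
by exists (maxn n K) => //=; exact: leq_maxl.
Qed.

Lemma limn_einf_ge (R : realType) (u : nat -> \bar R) (a : \bar R) K :
  (forall i, (K <= i)%N -> (a <= u i)%E) -> (a <= limn_einf u)%E.
Proof.
move=> uK; rewrite limn_einfE; apply: le_ereal_sup_tmp.
exists (einfs u K); first by exists K.
by apply: le_ereal_inf_tmp => _ [i /= Ki <-]; exact: uK.
Qed.

Lemma limn_einf_lt_often (R : realType) (u : nat -> \bar R) (a : \bar R) K :
  (limn_einf u < a)%E -> exists2 i, (K <= i)%N & (u i < a)%E.
Proof.
apply: contraPP => H; apply/negP; rewrite -leNgt; apply: (@limn_einf_ge _ _ _ K).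
by move=> i Ki; rewrite leNgt; apply/negP => ua; apply: H; exists i.
Qed.

(** The weights [2 ^+ j] bound the increments by a geometric sequence, since
    each term of a convergent series of squares is bounded by the sum. *)
Lemma cvgn_of_summable_increments (R : realType) (y : nat -> R) :
  (\sum_(j <oo) ((2 ^+ j * (y j.+1 - y j)) ^+ 2)%:E < +oo)%E -> cvgn y.
Proof.
set S := (X in (X < _)%E) => Soo.
have F0 j : (0 <= ((2 ^+ j * (y j.+1 - y j)) ^+ 2)%:E)%E by rewrite lee_fin sqr_ge0.
have S0 : (0 <= S)%E by exact: nneseries_ge0.
have Sfin : S \is a fin_num by rewrite ge0_fin_numE.
pose M := fine S; have M0 : 0 <= M by rewrite fine_ge0.
have FM j : (2 ^+ j * (y j.+1 - y j)) ^+ 2 <= M.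
  rewrite -lee_fin /M fineK//.
  apply: (le_trans _ (@nneseries_lim_ge _ _ xpredT 0%N j.+1 _)) => //.
  by rewrite big_mkord big_ord_recr/= leeDr// sume_ge0.
have incr j : `|y j.+1 - y j| <= geometric (1 + M) 2^-1 j.
  rewrite /= exprVn ler_pdivlMr ?exprn_gt0//.
  rewrite -ler_sqr ?nnegrE ?mulr_ge0 ?exprn_ge0 ?addr_ge0//.
  rewrite exprMn real_normK ?num_real// mulrC -exprMn (le_trans (FM j))//; nra.
have cs : cvgn (series (telescope y)).
  apply: normed_cvg; apply: (@series_le_cvg _ _ (geometric (1 + M) 2^-1)).
  - by move=> n; exact: normr_ge0.
  - by move=> n; rewrite (le_trans _ (incr n)).
  - by move=> n; exact: incr.
  - by apply: is_cvg_geometric_series; rewrite gtr0_norm ?invf_lt1 ?ltr1n.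
rewrite (_ : y = fun n => y 0%N + series (telescope y) n); last first.
  by apply/funext => n; exact: eq_sum_telescope.
by apply: is_cvgD => //; exact: is_cvg_cst.
Qed.

Section complete.
Context d (T : measurableType d) (R : realType).
Variable mu : {measure set T -> \bar R}.
Variable D : set T.
Hypothesis mD : measurable D.
Local Notation sqnorm := (sqnorm mu D).

(** By monotone convergence the sum has integral at most 1, so it is finite
    almost everywhere.  This is the device that turns convergence in mean into
    pointwise convergence along a fast subsequence. *)
Lemma summable_ae (F : nat -> T -> \bar R) :
  (forall i, measurable_fun D (F i)) -> (forall i x, D x -> (0 <= F i x)%E) ->
  (forall i, \int[mu]_(x in D) F i x <= (1 / (2 ^ i.+1)%:R)%:E)%E ->
  {ae mu, forall x, D x -> (\sum_(i <oo) F i x < +oo)%E}.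
Proof.
move=> mF F0 IF.
have mS : measurable_fun D (fun x => \sum_(i <oo) F i x)%E.
  by apply: (@ge0_emeasurable_sum _ _ _ _ F) => // i x Dx _; exact: F0.
have S0 x : D x -> (0 <= \sum_(i <oo) F i x)%E.
  by move=> Dx; apply: nneseries_ge0 => i _ _; exact: F0.
have iS : mu.-integrable D (fun x => \sum_(i <oo) F i x)%E.
  apply/integrableP; split => //.
  rewrite (eq_integral (fun x => \sum_(i <oo) F i x)%E); last first.
    by move=> x; rewrite inE => Dx; rewrite gee0_abs// S0.
  rewrite integral_nneseries//.
  apply: (@le_lt_trans _ _ 1%E); last by rewrite ltry.
  apply: le_trans (@epsilon_trick0 R 1 xpredT ler01).
  by apply: lee_nneseries => // i _ _; apply: integral_ge0 => x Dx; exact: F0.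
have := integrable_ae mD iS; apply: filterS => x Sx Dx.
by rewrite -ge0_fin_numE ?S0// Sx.
Qed.

(** Expanding the square, the two squared norms differ by the squared norm of
    the difference and by twice a cross term. *)
Lemma cvg_sqnorm (f_ : nat -> T -> R) f :
  (forall i, measurable_fun D (f_ i)) -> measurable_fun D f ->
  (sqnorm f < +oo)%E -> sqnorm (fun x => f_ i x - f x)%R @[i --> \oo] --> 0%E ->
  sqnorm (f_ i) @[i --> \oo] --> sqnorm f.
Proof.
move=> mf_ mf foo fc.
have md i : measurable_fun D (fun x => f_ i x - f x) by exact: measurable_funB.
have mc i : measurable_fun D (fun x => `|(f_ i x - f x) * f x|).
  by apply: measurableT_comp => //; exact: measurable_funM.
have cc := cvg_integral_cross mD md mf foo fc.
pose c i := (\int[mu]_(x in D) `|(f_ i x - f x) * f x|%:E)%E.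
pose X i := (sqnorm (fun x => f_ i x - f x)%R + 2%:E * c i)%E.
have X0 : X i @[i --> \oo] --> 0%E.
  rewrite -[0%E]adde0; apply: cvgeD => //.
  by rewrite -(mule0 2%:E); apply: cvgeZl.
have fin : sqnorm f \is a fin_num by rewrite ge0_fin_numE ?sqnorm_ge0.
have c2E i : (2%:E * c i = \int[mu]_(x in D) (2 * `|(f_ i x - f x) * f x|)%:E)%E.
  by rewrite -ge0_integralZl_EFin//; exact/measurable_EFinP.
have m2 i : measurable_fun D (EFin \o (fun x => 2 * `|(f_ i x - f x) * f x|)).
  by apply/measurable_EFinP; exact: measurable_funM.
have p2 i x : D x -> (0 <= (2 * `|(f_ i x - f x) * f x|)%:E)%E.
  by rewrite lee_fin mulr_ge0.
have q2 (h : T -> R) x : D x -> (0 <= (h x ^+ 2)%:E)%E.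
  by rewrite lee_fin sqr_ge0.
have ab (a : R) : - `|a| <= a <= `|a| by rewrite -ler_norml.
apply: (@squeeze_cvge _ _ _ _ (fun i => sqnorm f - X i)%E _
   (fun i => sqnorm f + X i)%E); last 2 first.
- rewrite -[X in _ --> X]sube0.
  by apply: (@cvgeB _ _ _ _ (cst (sqnorm f)) X) => //; [rewrite fin_num_adde_defr|exact: cvg_cst].
- rewrite -[X in _ --> X]adde0.
  by apply: (@cvgeD _ _ _ _ (cst (sqnorm f)) X) => //; [rewrite fin_num_adde_defl|exact: cvg_cst].
apply: nearW => i; apply/andP; split.
- have Xi0 : (0 <= X i)%E.
    by rewrite adde_ge0 ?sqnorm_ge0// c2E integral_ge0//; exact: p2.
  have [Xfin|] := boolP (X i \is a fin_num); last first.
    rewrite ge0_fin_numE// -leNgt leye_eq => /eqP ->.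
    by rewrite -(fineK fin) leNye.
  rewrite leeBlDr//.
  apply: (@le_trans _ _ (sqnorm (f_ i) + 2%:E * c i)%E); last first.
    by rewrite leeD2l// leeDr// sqnorm_ge0.
  rewrite c2E -ge0_integralD//; try by [exact: q2|exact: measurable_sqr|exact: p2|exact: m2].
  apply: ge0_le_integral => //; first exact: q2.
  + exact: measurable_sqr.
  + by apply: emeasurable_funD; [exact: measurable_sqr|exact: m2].
  move=> x _; rewrite -EFinD lee_fin.
  by have /andP[] := ab ((f_ i x - f x) * f x); have := sqr_ge0 (f_ i x - f x); nra.
- rewrite /X c2E -ge0_integralD//; try by [exact: q2|exact: measurable_sqr|exact: p2|exact: m2].
  have m3 : measurable_fun D (fun x => (f_ i x - f x) ^+ 2 +
      2 * `|(f_ i x - f x) * f x|).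
    by apply: measurable_funD; [exact: measurable_funX|apply/measurable_EFinP].
  under [X in (_ + X)%E]eq_integral do rewrite -EFinD.
  rewrite -ge0_integralD//; first last.
  + exact/measurable_EFinP.
  + by move=> x Dx; rewrite lee_fin addr_ge0 ?sqr_ge0 ?mulr_ge0.
  + exact: measurable_sqr.
  + by move=> x Dx; exact: q2.
  apply: ge0_le_integral => //; first exact: q2.
  + exact: measurable_sqr.
  + apply/measurable_EFinP; apply: measurable_funD => //.
    exact: measurable_funX.
  move=> x _; rewrite -!EFinD lee_fin.
  by have /andP[] := ab ((f_ i x - f x) * f x); nra.
Qed.

(** Riesz-Fischer for real representatives: a fast subsequence converges
    almost everywhere, and Fatou's lemma upgrades the pointwise limit to a
    limit in mean square. *)
Lemma sqnorm_complete (f_ : nat -> T -> R) :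
  (forall i, measurable_fun D (f_ i)) ->
  (forall e : R, 0 < e -> exists K, forall i j, (K <= i)%N -> (K <= j)%N ->
     (sqnorm (fun x => f_ i x - f_ j x)%R <= e%:E)%E) ->
  exists f : T -> R, measurable_fun D f /\
    sqnorm (fun x => f_ i x - f x)%R @[i --> \oo] --> 0%E.
Proof.
move=> mf cf.
(* [4 ^+ j] pays for the square of the weight [2 ^+ j] in the increments *)
pose e (j : nat) : R := (4 ^+ j)^-1 * (1 / (2 ^ j.+1)%:R).
have e0 j : 0 < e j.
  by rewrite mulr_gt0 ?invr_gt0 ?exprn_gt0 ?divr_gt0 ?ltr0n ?expn_gt0.
have /choice[K HK] j := cf (e j) (e0 j).
pose k j := (\sum_(i < j.+1) (K i).+1)%N.
have kS j : (k j.+1 = k j + (K j.+1).+1)%N by rewrite /k big_ord_recr.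
have kK j : (K j <= k j)%N.
  by rewrite /k big_ord_recr/= (leq_trans (leqnSn _))// leq_addl.
have kj j : (j <= k j)%N.
  by elim: j => // j IH; rewrite kS addnS ltnS (leq_trans IH)// leq_addr.
pose g j := f_ (k j).
have mg j : measurable_fun D (g j) by exact: mf.
pose F j x := (2 ^+ j * (g j.+1 x - g j x)) ^+ 2.
have mF j : measurable_fun D (F j).
  by apply: measurable_funX; apply: measurable_funM => //; exact: measurable_funB.
have : {ae mu, forall x, D x -> (\sum_(i <oo) (F i x)%:E < +oo)%E}.
  apply: (@summable_ae (fun i => EFin \o F i)) => [i|i x _|].
  - exact/measurable_EFinP.
  - by rewrite lee_fin sqr_ge0.
  move=> j; rewrite -/(sqnorm (fun x => 2 ^+ j * (g j.+1 x - g j x))).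
  rewrite sqnormZ//; last exact: measurable_funB.
  have -> : ((2 : R) ^+ j ^+ 2 = 4 ^+ j) by rewrite exprAC -natrX.
  have -> : (1 / (2 ^ j.+1)%:R = 4 ^+ j * e j :> R).
    by rewrite /e mulVKf// expf_neq0.
  rewrite EFinM lee_pmul2l ?lte_fin ?exprn_gt0//.
  by apply: HK => //; rewrite (leq_trans (kK j))// kS leq_addr.
move=> sF.
(* the superior limit is measurable whether or not the limit exists *)
pose f x := fine (limn_esup (fun j => (g j x)%:E)).
have fE x : cvgn (g^~ x) -> g j x @[j --> \oo] --> f x.
  move=> /cvg_ex[l gl].
  have gl' : (g j x)%:E @[j --> \oo] --> l%:E by apply: cvg_EFin; [exact: nearW|].
  by rewrite /f (cvg_limn_einf_sup gl').2.
have mff : measurable_fun D f.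
  apply: (measurableT_comp (f := fine)); first exact: fine_measurable.
  apply: (@measurable_fun_limn_esup _ _ _ _ (fun j x => (g j x)%:E)) => j.
  exact/measurable_EFinP.
exists f; split=> //.
apply/cvg0_eP; first by move=> i; exact: sqnorm_ge0.
move=> a a0; have [N HN] := cf a a0; exists N => i Ni.
pose G j x := ((f_ i x - g j x) ^+ 2)%:E.
have mG j : measurable_fun D (G j).
  by apply/measurable_EFinP; apply: measurable_funX; exact: measurable_funB.
have G0 j x : D x -> (0 <= G j x)%E by rewrite lee_fin sqr_ge0.
apply: (@le_trans _ _ (\int[mu]_(x in D) limn_einf (G^~ x))%E); last first.
  apply: le_trans (fatou mu mD mG G0) _.
  by apply: (@limn_einf_le _ _ _ N) => j Nj; apply: HN => //; rewrite (leq_trans Nj).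
apply: ae_ge0_le_integral => //.
- by move=> x _; rewrite lee_fin sqr_ge0.
- by apply: measurable_sqr; exact: measurable_funB.
- by move=> x Dx; apply: (@limn_einf_ge _ _ _ 0%N) => j _; exact: G0.
- apply: (measurableT_comp (f := -%E)) => //.
  apply: (@measurable_fun_limn_esup _ _ _ _ (fun j x => - G j x)%E) => j.
  exact: measurableT_comp.
apply: filterS sF => x /[apply] /cvgn_of_summable_increments /fE gf.
have Gf : G j x @[j --> \oo] --> ((f_ i x - f x) ^+ 2)%:E.
  apply: cvg_EFin; first exact: nearW.
  have gf' : f_ i x - g j x @[j --> \oo] --> f_ i x - f x.
    by apply: cvgB => //; exact: cvg_cst.
  exact: (cvgM gf' gf').
by rewrite (cvg_limn_einf_sup Gf).1.
Qed.

End complete.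

(** * Almost minimizers on shrinking convex sets *)
(** The infima of [N] over the decreasing sets [C k] increase to a finite
    limit s.  Late almost minimizers have [N] close to s, and their midpoint,
    which lies in the same [C k], has [N] almost at least s; the parallelogram
    inequality then forces them to be close.  Here [N] is the square of a norm
    and [dist] the square of the associated distance.  The lemma serves twice:
    for gradients, and for weak derivatives along a curve. *)
Lemma almost_minimizers_cauchy (R : realType) (X : Type) (C : nat -> set X)
    (mid : X -> X -> X) (N : X -> R) (dist : X -> X -> R) (B : R) :
  (forall i j, (i <= j)%N -> C j `<=` C i) ->
  (forall k x y, C k x -> C k y -> C k (mid x y)) ->
  (forall x, C 0%N x -> 0 <= N x) ->
  (forall k, exists2 x, C k x & N x <= B) ->
  (forall x y, C 0%N x -> C 0%N y ->
     dist x y <= 2 * N x + 2 * N y - 4 * N (mid x y)) ->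
  exists x_ : nat -> X,
    [/\ forall k, C k (x_ k),
        forall k y, C k y -> N (x_ k) <= N y + k.+1%:R^-1 &
        forall e, 0 < e -> exists K, forall i j, (K <= i)%N -> (K <= j)%N ->
          dist (x_ i) (x_ j) <= e].
Proof.
move=> Cle Cmid N0 CB par.
pose a k := inf (N @` C k).
have infk k : has_inf (N @` C k).
  split; first by have [x Cx _] := CB k; exists (N x), x.
  by exists 0 => _ [x Cx <-]; apply: N0; exact: Cle Cx.
have aN k x : C k x -> a k <= N x.
  by move=> Cx; apply: ge_inf; [exact: (infk k).2|exists x].
have /choice[x_ x_P] k : exists x, C k x /\ N x <= a k + k.+1%:R^-1.
  have [||_ [x Cx <-] xa] := @inf_adherent _ (N @` C k) k.+1%:R^-1.
  - by rewrite invr_gt0 ltr0n.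
  - exact: infk.
  - by exists x; split => //; exact: ltW.
exists x_; split.
- by move=> k; have [] := x_P k.
- by move=> k y Cy; rewrite (le_trans (x_P k).2)// lerD2r aN.
move=> e e0.
have ainc i j : (i <= j)%N -> a i <= a j.
  move=> ij; apply: lb_le_inf; first exact: (infk j).1.
  by move=> _ [x Cx <-]; apply: aN; exact: Cle Cx.
have aB k : a k <= B.
  by have [x Cx xB] := CB k; rewrite (le_trans (aN _ _ Cx)).
have supa : has_sup (range a).
  by split; [exists (a 0%N), 0%N|exists B => _ [k _ <-]].
pose s := sup (range a).
have aS k : a k <= s by apply: ub_le_sup; [exact: supa.2|exists k].
have e8 : 0 < e / 8 by rewrite divr_gt0.
have [_ [K1 _ <-] sK1] := sup_adherent e8 supa.
have [K2 K2e] : exists k, k.+1%:R^-1 < e / 8.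
  have [k _ Hk] := near_infty_natSinv_lt (PosNum e8).
  by exists k; exact: (Hk k (leqnn k)).
exists (maxn K1 K2) => i j; rewrite !geq_max => /andP[K1i K2i] /andP[K1j K2j].
have bnd m : (K2 <= m)%N -> N (x_ m) <= s + e / 8.
  move=> K2m; rewrite (le_trans (x_P m).2)// lerD ?aS//.
  by apply: le_trans (ltW K2e); rewrite lef_pV2 ?posrE ?ltr0n// ler_nat ltnS.
have Cm m : (K1 <= m)%N -> C K1 (x_ m).
  by move=> K1m; apply: (Cle _ _ K1m); have [] := x_P m.
have mm : s - e / 8 <= N (mid (x_ i) (x_ j)).
  by apply: (le_trans (ltW sK1)); apply: aN; apply: Cmid; exact: Cm.
have C0 m : (K1 <= m)%N -> C 0%N (x_ m) by move=> /Cm; exact: Cle.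
apply: (le_trans (par _ _ (C0 _ K1i) (C0 _ K1j))).
have := bnd i K2i; have := bnd j K2j; lra.
Qed.

(** * Square integrability on Euclidean space *)
Lemma enorm_sqr (R : realType) n (x : 'rV[R]_n) :
  enorm x ^+ 2 = \sum_(i < n) x 0 i ^+ 2.
Proof. by rewrite sqr_sqrtr// sumr_ge0// => i _; exact: sqr_ge0. Qed.

Lemma enorm_ge0 (R : realType) n (x : 'rV[R]_n) : 0 <= enorm x.
Proof. exact: sqrtr_ge0. Qed.

Lemma coord_le_enorm (R : realType) n (x : 'rV[R]_n) i : `|x 0 i| <= enorm x.
Proof.
rewrite -ler_sqr ?nnegrE ?enorm_ge0// enorm_sqr real_normK ?num_real//.
by rewrite (bigD1 i)//= lerDl sumr_ge0// => j _; exact: sqr_ge0.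
Qed.

Section Lfun_sqnorm.
Context (R : realType) (n : nat).
Variable mu : {measure set (borelRn R n) -> \bar R}.
Local Notation sqnorm := (@sqnorm _ (borelRn R n) R mu setT).

Lemma normL2E (f : 'rV[R]_n -> R) : normL2 mu f = (sqnorm f `^ 2^-1)%E.
Proof.
rewrite /normL2 unlock; congr (_ `^ _)%E.
apply: eq_integral => x _ /=.
by rewrite powR_mulrn// real_normK// num_real.
Qed.

Lemma Lfun2P (f : 'rV[R]_n -> R) : f \in Lfun mu 2%:E <->
  @measurable_fun _ _ (borelRn R n) R setT f /\ (sqnorm f < +oo)%E.
Proof.
split.
- move=> /[dup] /Lfun2_integrable_sqr /integrableP[_ fi].
  rewrite inE => /andP[/[!inE] mf _]; split=> //.
  apply: le_lt_trans fi; rewrite le_eqVlt; apply/orP; left; apply/eqP.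
  by apply: eq_integral => x _; rewrite gee0_abs// lee_fin sqr_ge0.
- move=> [mf foo]; rewrite inE; apply/andP; split; rewrite inE//.
  by rewrite /finite_norm/= -/(normL2 mu f) normL2E poweR_lty.
Qed.

Lemma normL2_cvg0 (f_ : nat -> 'rV[R]_n -> R) :
  normL2 mu (f_ i) @[i --> \oo] --> 0%E <-> sqnorm (f_ i) @[i --> \oo] --> 0%E.
Proof.
have h0 i : (0 <= sqnorm (f_ i))%E by exact: sqnorm_ge0.
have n0 i : (0 <= normL2 mu (f_ i))%E by exact: Lnorm_ge0.
split => [/(cvg0_eP n0) H|/(cvg0_eP h0) H].
- apply/cvg0_eP => // e e0.
  have [|K HK] := H (Num.sqrt e); first by rewrite sqrtr_gt0.
  exists K => i Ki; have := HK _ Ki; rewrite normL2E => He.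
  have : (((sqnorm (f_ i) `^ 2^-1)) `^ 2 <= (Num.sqrt e)%:E `^ 2)%E.
    by rewrite gt0_ler_poweR// ?in_itv/= ?leey ?poweR_ge0 ?lee_fin ?sqrtr_ge0.
  rewrite -poweRrM mulVf// poweRe1// poweR_EFin powR_mulrn ?sqrtr_ge0//.
  by rewrite sqr_sqrtr// ltW.
- apply/cvg0_eP => // e e0.
  have [|K HK] := H (e ^+ 2); first by rewrite exprn_gt0.
  exists K => i Ki; rewrite normL2E.
  have : ((sqnorm (f_ i) `^ 2^-1) <= (e ^+ 2)%:E `^ 2^-1)%E.
    by rewrite gt0_ler_poweR// ?in_itv/= ?leey ?h0 ?lee_fin ?sqr_ge0// HK.
  by rewrite /= powR12_sqrt ?sqr_ge0// sqrtr_sqr gtr0_norm.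
Qed.

End Lfun_sqnorm.

(** * Joint measurability of evaluation *)
Section curves.
Context (R : realType) (n : nat).
Implicit Types g h : curve R n.

Lemma curve_within_continuous g : {within `[0, 1], continuous g}.
Proof. by case: g. Qed.

Lemma curve_cvg g (t : R) : 0 < t < 1 -> g s @[s --> t] --> g t.
Proof.
move=> t01; apply: (within_continuous_continuous ltr01 (@curve_within_continuous g)).
by rewrite in_itv.
Qed.

Lemma enorm_continuous : continuous (@enorm R n).
Proof.
move=> x; apply: (continuous_comp (g := Num.sqrt)); last exact: sqrt_continuous.
apply: continuous_big => [|i _ y]; first exact: add_continuous.
have yi : z 0 i @[z --> y] --> y 0 i by exact: coord_continuous.
exact: (cvgM yi yi).
Qed.

(** The supremum defining [curve_dist] is attained, hence it is a bound. *)
Lemma enorm_le_curve_dist g h (t : R) : 0 <= t <= 1 ->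
  enorm (g t - h t) <= curve_dist g h.
Proof.
move=> t01; pose f s := enorm (g s - h s).
have cf : {within `[0, 1], continuous f}.
  apply: (@within_continuous_comp _ _ _ _ (fun s => g s - h s) (@enorm R n)).
    by move=> x _; exact: enorm_continuous.
  by apply: within_continuousB; exact: curve_within_continuous.
have [c c01 fc] := EVT_max ler01 cf.
apply: ub_le_sup; last by exists t => //=; rewrite in_itv.
by exists (f c) => _ [s s01 <-]; apply: fc.
Qed.

(** Evaluation is 1-Lipschitz for the supremum distance. *)
Lemma measurable_evalC (t : R) : 0 <= t <= 1 ->
  measurable_fun setT (@evalC R n t).
Proof.
move=> t01; apply: (@measurability _ _ (borelC R n) (borelRn R n) setT (@evalC R n t)
  (@open 'rV[R]_n)) => //.
move=> _ [U oU <-]; rewrite setTI; apply: sub_sigma_algebra => g Ug.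
have /nbhs_ballP[e e0 eU] : nbhs (g t) U by exact: open_nbhs_nbhs.
exists e => // h gh; apply: eU; split=> // i j.
rewrite ord1 /ball/= (le_lt_trans _ gh)//.
rewrite (le_trans _ (enorm_le_curve_dist g h t01))//.
by rewrite (le_trans _ (coord_le_enorm _ j))// !mxE.
Qed.


Definition grid_floor (k : nat) (t : R) : R :=
  (Num.trunc (k.+1%:R * t))%:R / k.+1%:R.

Lemma grid_itv (k j : nat) (t : R) : 0 <= t ->
  (j%:R / k.+1%:R <= t < j.+1%:R / k.+1%:R) = (Num.trunc (k.+1%:R * t) == j).
Proof.
move=> t0; have k0 : (0 : R) < k.+1%:R by rewrite ltr0n.
by rewrite truncn_eq ?mulr_ge0// ler_pdivrMr// ltr_pdivlMr// mulrC.
Qed.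

Lemma grid_floor_itv (k : nat) (t : R) : 0 <= t ->
  grid_floor k t <= t < grid_floor k t + k.+1%:R^-1.
Proof.
move=> t0; have := grid_itv k (Num.trunc (k.+1%:R * t)) t0.
by rewrite eqxx -(natr1 (Num.trunc _)) mulrDl mul1r => ->.
Qed.

Lemma grid_floor_cvg (t : R) : 0 <= t ->
  grid_floor k t @[k --> \oo] --> t.
Proof.
move=> t0; apply/cvgrPdist_lt => e e0.
have [K _ HK] := near_infty_natSinv_lt (PosNum e0).
exists K => // k /HK /= ke.
have /andP[h1 h2] := grid_floor_itv k t0.
by rewrite ger0_norm ?subr_ge0// ltrBlDl (lt_trans h2)// ltrD2l.
Qed.

Local Notation I01 := (`]0%R, 1%R[%classic : set (measurableTypeR R)).

(** Curves are approximated by sampling them on finer and finer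
    grids, and a sampled evaluation is a countable union of products of
    measurable sets.  For an open set [U], lying in [U] at time t means lying,
    at all late sampling times, at distance at least 1/(m+1) from the
    complement of [U] for some m.  Time is restricted to the open interval,
    where curves are continuous in the usual sense. *)
Lemma measurable_joint_eval :
  measurable_fun (setT `*` I01 : set (borelC R n * measurableTypeR R))
    (fun p => (p.1 : curve R n) p.2 : borelRn R n).
Proof.
apply: (@measurability _ _ (borelC R n * measurableTypeR R)%type (borelRn R n) _ _
  (@open 'rV[R]_n)) => //.
move=> _ [U oU <-].
pose Um m : set 'rV[R]_n := ~` \bigcup_(y in ~` U) ball y m.+1%:R^-1.
have mUm m : measurable (Um m : set (borelRn R n)).
  apply: measurableC; apply: sub_sigma_algebra.
  by apply: bigcup_open => y _; apply: ball_open; rewrite invr_gt0 ltr0n.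
pose cell (k j : nat) : set (measurableTypeR R) :=
  `[j%:R / k.+1%:R, j.+1%:R / k.+1%:R[%classic.
pose A m k := \bigcup_(j in `I_k.+1)
  ((@evalC R n (j%:R / k.+1%:R) @^-1` Um m : set (borelC R n)) `*` cell k j).
have mA m k : measurable (A m k).
  apply: bigcup_measurable => j /= jk; apply: measurableX; last exact: measurable_itv.
  rewrite -[X in measurable X]setTI; apply: measurable_evalC => //.
  rewrite divr_ge0//= ler_pdivrMr ?ltr0n// mul1r ler_nat.
  exact: ltnW.
rewrite (_ : _ `&` _ = (setT `*` I01) `&`
  \bigcup_m \bigcup_N \bigcap_(k in [set k | (N <= k)%N]) A m k).
  apply: measurableI; first by apply: measurableX => //; exact: measurable_itv.
  apply: bigcupT_measurable => m; apply: bigcupT_measurable => N.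
  by apply: bigcap_measurable => //; exists N => /=.
have AE m k (g : curve R n) (t : R) : 0 < t < 1 ->
    A m k (g, t) <-> Um m (g (grid_floor k t)).
  move=> /andP[t0 t1]; split.
    move=> [j _ [/= gj]]; rewrite /cell/= in_itv/= grid_itv ?(ltW t0)//.
    by move=> /eqP tj; rewrite /grid_floor tj.
  move=> H; exists (Num.trunc (k.+1%:R * t)).
    rewrite /= truncn_lt_nat ?mulr_ge0 ?(ltW t0)//.
    by rewrite gtr_pMr// ltr0n.
  split => //=; rewrite /cell/= in_itv/= grid_itv ?(ltW t0)//.
apply/seteqP; split => -[g t] [[_ /= t01] H]; split=> //.
  have {}t01 : 0 < t < 1 by move: t01; rewrite in_itv.
  have t0 : 0 <= t by case/andP: t01 => /ltW.
  have cg : g (grid_floor k t) @[k --> \oo] --> g t.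
    exact: (cvg_comp _ _ (grid_floor_cvg t0) (curve_cvg t01)).
  have /nbhs_ballP[e /= e0 eU] : nbhs (g t) U by exact: open_nbhs_nbhs.
  have e2 : 0 < e / 2 by rewrite divr_gt0.
  have [m _ /(_ m (leqnn m)) /= me] := near_infty_natSinv_lt (PosNum e2).
  have [N _ HN] := cvg_ball cg e2.
  exists m => //; exists N => // k /= Nk; apply/(AE _ _ _ _ t01).
  move=> [y nUy gy]; apply: nUy; apply: eU.
  rewrite (splitr e); apply: (ball_triangle (HN k Nk)).
  by apply: ball_sym; apply: le_ball gy; exact: ltW.
move: H => [m _ [N _ HN]].
have {}t01 : 0 < t < 1 by move: t01; rewrite in_itv.
have t0 : 0 <= t by case/andP: t01 => /ltW.
have cg : g (grid_floor k t) @[k --> \oo] --> g t.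
  exact: (cvg_comp _ _ (grid_floor_cvg t0) (curve_cvg t01)).
have m0 : 0 < m.+1%:R^-1 :> R by rewrite invr_gt0 ltr0n.
have [K _ HK] := cvg_ball cg m0.
have /(AE _ _ _ _ t01) := HN (maxn N K) (leq_maxl _ _).
apply: contra_notP => nU; exists (g t) => //.
exact: (HK _ (leq_maxr _ _)).
Qed.

End curves.

(** * Quadratic functionals along the curves of a test plan *)
Section test_plan_bound.
Context (R : realType) (n : nat).
Variable mu : {measure set (borelRn R n) -> \bar R}.
Local Notation I01 := (`]0%R, 1%R[%classic : set (measurableTypeR R)).
Local Notation leb := (@lebesgue_measure R).
Local Notation sqnormI := (@sqnorm _ (measurableTypeR R) R leb I01).
Local Notation sqnormR := (@sqnorm _ (borelRn R n) R mu setT).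

Variable F : 'rV[R]_n -> R.
Hypothesis mF : @measurable_fun _ _ (borelRn R n) R setT F.

Let H : borelC R n * measurableTypeR R -> \bar R :=
  (fun p => (F ((p.1 : curve R n) p.2) ^+ 2)%:E) \_ (setT `*` I01).

Let mDI : measurable (setT `*` I01 : set (borelC R n * measurableTypeR R)).
Proof. by apply: measurableX => //; exact: measurable_itv. Qed.

Let mFg : measurable_fun (setT `*` I01 : set (borelC R n * measurableTypeR R))
  (fun p => F ((p.1 : curve R n) p.2)).
Proof.
have := measurableT_comp mF (@measurable_joint_eval R n).
exact.
Qed.

Let mH : measurable_fun setT H.
Proof.
have := (measurable_EFinP _ _).2 (measurable_funX 2 mFg).
exact: (measurable_restrictT _ mDI).1.
Qed.

Let H0 p : (0 <= H p)%E.
Proof. by apply: erestrict_ge0 => q _; rewrite lee_fin sqr_ge0. Qed.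

Let HE (g : borelC R n) (t : measurableTypeR R) :
  H (g, t) = ((fun t => (F ((g : curve R n) t) ^+ 2)%:E) \_ I01) t.
Proof.
rewrite /H /patch; congr (if _ then _ else _).
by rewrite in_setX in_setT.
Qed.

(** A section of the jointly measurable map. *)
Lemma measurable_along_curve (g : curve R n) : measurable_fun I01 (F \o g).
Proof.
have mI : measurable I01 by exact: measurable_itv.
apply: (measurable_restrictT _ mI).2.
have mr := (measurable_restrictT _ mDI).1 mFg.
have := measurableT_comp mr (@pair1_measurable _ _ _ (measurableTypeR R) (g : borelC R n)).
apply: eq_measurable_fun => t _ /=; rewrite /patch.
by rewrite in_setX in_setT.
Qed.

Lemma measurable_sqnorm_curve :
  measurable_fun setT (fun g : borelC R n => sqnormI (F \o (g : curve R n))).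
Proof.
rewrite (_ : (fun _ => _) = fubini_F leb H); last first.
  apply/funext => g; rewrite /fubini_F /sqnorm [LHS]integral_mkcond.
  by apply: eq_integral => t _; rewrite HE.
exact: measurable_fun_fubini_tonelli_F.
Qed.

(** Tonelli's theorem reduces the bound to each fixed time, where it is the
    bound on the law of the position at that time. *)
Lemma integral_sqnorm_curve_le (pi : probability (borelC R n) R) (C : R) :
  0 < C ->
  (forall t : R, 0 <= t <= 1 ->
     forall A : set (borelRn R n), measurable A ->
       (pushforward pi (@evalC R n t) A <= C%:E * mu A)%E) ->
  (\int[pi]_g sqnormI (F \o (g : curve R n)) <= C%:E * sqnormR F)%E.
Proof.
move=> C0 piC.
have -> : (\int[pi]_g sqnormI (F \o (g : curve R n)) =
    \int[pi]_g \int[leb]_t H (g, t))%E.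
  apply: eq_integral => g _; rewrite /sqnorm [LHS]integral_mkcond.
  by apply: eq_integral => t _; rewrite HE.
rewrite fubini_tonelli//.
have bound (t : R) : 0 < t < 1 ->
    (\int[pi]_g (F (evalC t g) ^+ 2)%:E <= C%:E * sqnormR F)%E.
  move=> /andP[/ltW t0 /ltW t1].
  have t01 : 0 <= t <= 1 by rewrite t0.
  have mev := @measurable_evalC R n t t01.
  have := @ge0_integral_pushforward _ _ _ _ R _ mev pi setT
    (fun x => (F x ^+ 2)%:E) measurableT.
  rewrite preimage_setT => <-; last 2 first.
  - exact: measurable_sqr.
  - by move=> x _; rewrite lee_fin sqr_ge0.
  rewrite /sqnorm -(ge0_integral_mscale mu measurableT (NngNum (ltW C0)))//; last 2 first.
  - exact: measurable_sqr.
  - by move=> x _; rewrite lee_fin sqr_ge0.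
  apply: ge0_le_measure_integral => //.
  - by move=> A mA; exact: piC.
  - by move=> x; rewrite lee_fin sqr_ge0.
  - exact: measurable_sqr.
apply: (@le_trans _ _ (\int[leb]_(t in I01) cst (C%:E * sqnormR F) t)%E).
  rewrite [leRHS]integral_mkcond; apply: ge0_le_integral => //.
  - by move=> t _; exact: integral_ge0.
  - exact: (measurable_fun_fubini_tonelli_G H mH H0).
  - apply/(measurable_restrictT _ _).1; [exact: measurable_itv|exact: measurable_cst].
  move=> t _; rewrite /patch; case: ifPn => tI.
    apply: le_trans (bound t _); last by move: tI; rewrite inE/= in_itv.
    rewrite le_eqVlt; apply/orP; left; apply/eqP; apply: eq_integral => g _.
    by rewrite HE /patch tI.
  rewrite (eq_integral (cst 0%E)) ?integral0// => g _.
  by rewrite HE /patch (negbTE tI).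
rewrite integral_cst; last exact: measurable_itv.
rewrite [X in (_ * X)%E](_ : _ = 1%E) ?mule1//.
by rewrite /= lebesgue_measure_itv/= lte_fin ltr01 oppr0 adde0.
Qed.

End test_plan_bound.

(** * Weak derivatives on the unit interval *)
Section weak_derivatives.
Context (R : realType).
Local Notation I01 := (`]0%R, 1%R[%classic : set (measurableTypeR R)).
Local Notation leb := (@lebesgue_measure R).
Local Notation sqnormI := (@sqnorm _ (measurableTypeR R) R leb I01).

Let mI : measurable I01. Proof. exact: measurable_itv. Qed.

Lemma lebesgue_I01 : leb I01 = 1%E.
Proof. by rewrite /= lebesgue_measure_itv/= lte_fin ltr01 oppr0 adde0. Qed.

Definition bounded_test (phi : R -> R) :=
  measurable_fun I01 phi /\ exists M, forall t, I01 t -> `|phi t| <= M.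

Lemma continuous_bounded_test (phi : R -> R) : continuous phi -> bounded_test phi.
Proof.
move=> cphi; split.
  by apply: measurable_funS (continuous_measurable_fun cphi).
have cabs : {within `[0, 1], continuous (fun t => `|phi t|)}.
  apply: continuous_subspaceT => t.
  by apply: (continuous_comp (f := phi)); [exact: cphi|exact: norm_continuous].
have [c _ Hc] := EVT_max ler01 cabs.
exists `|phi c| => t; rewrite /= in_itv/= => /andP[/ltW t0 /ltW t1].
by apply: Hc; rewrite in_itv/= t0.
Qed.

Lemma Ccinfty_bounded_test (phi : R -> R) : Ccinfty phi ->
  bounded_test phi /\ bounded_test (derive1 phi).
Proof.
move=> [sphi _]; split; apply: continuous_bounded_test; first exact: (sphi 0%N).
have -> : derive1 phi = 'D_1 phi by apply/funext => t; rewrite derive1E.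
by have [_] := sphi 1%N; exact.
Qed.

Lemma sqnorm_mul_bounded (s phi : R -> R) : bounded_test phi ->
  measurable_fun I01 s -> (sqnormI s < +oo)%E ->
  (sqnormI (fun t => s t * phi t)%R < +oo)%E.
Proof.
move=> [mphi [M HM]] ms soo.
apply: (@le_lt_trans _ _ (sqnormI (fun t => M * s t)%R)).
  apply: le_sqnorm => //; [exact: measurable_funM|exact: measurable_funM|].
  move=> t It; rewrite mulrC !normrM ler_wpM2r//.
  by rewrite (le_trans (HM _ It))// ler_norm.
by rewrite sqnormZ// lte_mul_pinfty// lee_fin sqr_ge0.
Qed.

Lemma cst1_sqnorm : measurable_fun I01 (cst 1 : R -> R) /\
  (sqnormI (cst 1%R) < +oo)%E.
Proof.
split => //; rewrite /sqnorm (eq_integral (cst 1%E)); last first.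
  by move=> t _; rewrite /= expr1n.
rewrite integral_cst// [X in (_ * X)%E](_ : _ = 1%E) ?mule1 ?ltry//.
exact: lebesgue_I01.
Qed.

Lemma sqnorm_integrable (f : R -> R) : measurable_fun I01 f ->
  (sqnormI f < +oo)%E -> leb.-integrable I01 (EFin \o f).
Proof.
move=> mf foo; have [m1 oo1] := cst1_sqnorm.
have := integrable_mul mI mf m1 foo oo1.
by under [X in EFin \o X]eq_fun do rewrite mulr1.
Qed.

Lemma integrable_mul_bounded (u phi : R -> R) : bounded_test phi ->
  leb.-integrable I01 (EFin \o u) ->
  leb.-integrable I01 (EFin \o (fun t => u t * phi t)).
Proof.
move=> [mphi [M HM]] iu.
have mu : measurable_fun I01 u.
  by apply/measurable_EFinP; case/integrableP : iu.
apply: (le_integrable mI (g := fun t => M%:E * (u t)%:E)%E).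
- by apply/measurable_EFinP; exact: measurable_funM.
- move=> t It; rewrite -EFinM !abse_EFin lee_fin mulrC !normrM ler_wpM2r//.
  by rewrite (le_trans (HM _ It))// ler_norm.
- exact: (integrableZl mI M iu).
Qed.

Lemma integrable_weak_pairings (u w phi : R -> R) :
  leb.-integrable I01 (EFin \o u) -> leb.-integrable I01 (EFin \o w) ->
  Ccinfty phi ->
  leb.-integrable I01 (EFin \o (fun t => u t * derive1 phi t)) /\
  leb.-integrable I01 (EFin \o (fun t => w t * phi t)).
Proof.
by move=> iu iw /Ccinfty_bounded_test[b b']; split; exact: integrable_mul_bounded.
Qed.

Lemma W11_derivative_mid (u v u' v' : R -> R) :
  W11_derivative u u' -> W11_derivative v v' ->
  W11_derivative (fun t => 2^-1 * (u t + v t)) (fun t => 2^-1 * (u' t + v' t)).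
Proof.
move=> [iu iu' Hu] [iv iv' Hv]; split.
- exact: (integrableZl mI 2^-1 (integrableD mI iu iv)).
- exact: (integrableZl mI 2^-1 (integrableD mI iu' iv')).
move=> phi cphi sphi.
have [iuphi iu'phi] := integrable_weak_pairings iu iu' cphi.
have [ivphi iv'phi] := integrable_weak_pairings iv iv' cphi.
have lin (a b c : R -> R) :
   leb.-integrable I01 (EFin \o (fun t => a t * c t)) ->
   leb.-integrable I01 (EFin \o (fun t => b t * c t)) ->
   \int[leb]_(t in I01) (2^-1 * (a t + b t) * c t) =
   2^-1 * (\int[leb]_(t in I01) (a t * c t) + \int[leb]_(t in I01) (b t * c t)).
  move=> ia ib; rewrite -RintegralD// -RintegralZl//; last first.
    by have := integrableD mI ia ib.
  by apply: eq_Rintegral => t _; ring.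
by rewrite !lin// Hu// Hv//; ring.
Qed.

(** Both sides of the integration by parts formula are continuous for the
    mean square convergence of [u_] and [q_], the test function, its
    derivative and [s] being fixed.  Keeping [s] aside allows [q_] to converge
    in L^2, although the product with [s] only converges in L^1. *)
Lemma W11_derivative_limit (u q s : R -> R) (u_ q_ : nat -> R -> R) :
  measurable_fun I01 u -> (sqnormI u < +oo)%E ->
  measurable_fun I01 q -> (sqnormI q < +oo)%E ->
  measurable_fun I01 s -> (sqnormI s < +oo)%E ->
  (forall k, measurable_fun I01 (u_ k)) -> (forall k, measurable_fun I01 (q_ k)) ->
  (forall k, W11_derivative (u_ k) (fun t => q_ k t * s t)) ->
  sqnormI (fun t => u_ k t - u t)%R @[k --> \oo] --> 0%E ->
  sqnormI (fun t => q_ k t - q t)%R @[k --> \oo] --> 0%E ->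
  W11_derivative u (fun t => q t * s t).
Proof.
move=> mu uoo mq qoo ms soo mu_ mq_ W ucvg qcvg.
have iu := sqnorm_integrable mu uoo.
have iqs := integrable_mul mI mq ms qoo soo.
split => // phi cphi sphi.
have [iuphi iqphi] := integrable_weak_pairings iu iqs cphi.
have [b b'] := Ccinfty_bounded_test cphi.
have [m1 oo1] := cst1_sqnorm.
have [mphi _] := b; have [mphi' _] := b'.
have phi'oo : (sqnormI (derive1 phi) < +oo)%E.
  apply: le_lt_trans (sqnorm_mul_bounded b' m1 oo1).
  rewrite le_eqVlt; apply/orP; left; apply/eqP.
  by apply: eq_sqnorm => t _; rewrite mul1r.
have c1 := cvg_integral_cross mI (fun k => measurable_funB (mu_ k) mu) mphi' phi'oo ucvg.
have msphi : measurable_fun I01 (fun t => s t * phi t) by exact: measurable_funM.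
have sphioo := sqnorm_mul_bounded b ms soo.
have c2 := cvg_integral_cross mI (fun k => measurable_funB (mq_ k) mq) msphi sphioo qcvg.
pose A k := (\int[leb]_(t in I01) `|(u_ k t - u t) * derive1 phi t|%:E)%E.
pose B k := (\int[leb]_(t in I01) `|(q_ k t - q t) * (s t * phi t)|%:E)%E.
have c12 : (A k + B k)%E @[k --> \oo] --> 0%E.
  by rewrite -[X in _ --> X]adde0; apply: (@cvgeD _ _ _ _ A B).
have n0 k : (0 <= A k + B k)%E.
  by rewrite adde_ge0// integral_ge0// => t _; rewrite lee_fin.
apply/eqP; rewrite -subr_eq0 opprK -normr_le0; apply/ler_addgt0Pr => e e0.
rewrite add0r.
have [k /(_ k (leqnn k)) ke] := (cvg0_eP n0).1 c12 e e0.
rewrite -lee_fin (le_trans _ ke)//.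
have [iuk iwk Huk] := W k.
have [iukphi iwkphi] := integrable_weak_pairings iuk iwk cphi.
have iA : leb.-integrable I01 (EFin \o (fun t => (u_ k t - u t) * derive1 phi t)).
  have := integrableB mI iukphi iuphi.
  by apply: eq_integrable => // t _; rewrite /= mulrBl EFinB.
have iB : leb.-integrable I01 (EFin \o (fun t => (q_ k t - q t) * (s t * phi t))).
  have := integrableB mI iwkphi iqphi.
  by apply: eq_integrable => // t _; rewrite /= !mulrA !mulrBl EFinB.
have -> : \int[leb]_(t in I01) (u t * derive1 phi t) +
    \int[leb]_(t in I01) (q t * s t * phi t) =
  - (\int[leb]_(t in I01) ((u_ k t - u t) * derive1 phi t) +
     \int[leb]_(t in I01) ((q_ k t - q t) * (s t * phi t))).
  under [X in - (X + _)]eq_Rintegral do rewrite mulrBl.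
  under [X in - (_ + X)]eq_Rintegral do rewrite mulrA !mulrBl.
  by rewrite !RintegralB// Huk//; ring.
rewrite normrN (le_trans (lee_tofin (ler_normD _ _)))// EFinD leeD//.
- by rewrite EFin_normr_Rintegral//;
    exact: (le_abse_integral _ mI (measurable_int _ iA)).
- by rewrite EFin_normr_Rintegral//;
    exact: (le_abse_integral _ mI (measurable_int _ iB)).
Qed.

End weak_derivatives.

(** * Almost everywhere consequences of mean square convergence *)
Section ae_sqnorm.
Context d (T : measurableType d) (R : realType).
Variable mu : {measure set T -> \bar R}.

(** The integral of a nonnegative function is a supremum over the simple
    functions below it, so it is monotone even when the larger function is not
    measurable: [g] will be a squared speed, which is not known to be
    measurable. *)
Lemma le_lower_integral (D E : set T) (f g : T -> \bar R) :
  measurable D -> D `<=` E -> measurable_fun D f ->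
  (forall x, D x -> 0 <= f x)%E -> (forall x, E x -> 0 <= g x)%E ->
  {ae mu, forall x, D x -> (f x <= g x)%E} ->
  (\int[mu]_(x in D) f x <= \int[mu]_(x in E) g x)%E.
Proof.
move=> mD DE mf f0 g0 [N [mN N0 fg]].
rewrite (ge0_negligible_integral mN mD mf f0 N0) [leLHS]integral_mkcond.
rewrite [leRHS]integral_mkcond.
have f0' x : (0 <= (f \_ (D `\` N)) x)%E.
  by apply: erestrict_ge0 => y [Dy _]; exact: f0.
have g0' x : (0 <= (g \_ E) x)%E by exact: erestrict_ge0.
rewrite !ge0_integralTE//; apply: ereal_sup_le => _ [h hf <-]; exists h => //= x.
apply: (le_trans (hf x)); rewrite [leLHS]/patch; case: ifPn => // /set_mem[Dx Nx].
rewrite /patch mem_set; last exact: DE.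
by apply: contra_notT Nx => fgx; apply: fg => /= /(_ Dx); exact/negP.
Qed.

Variable D : set T.
Hypothesis mD : measurable D.
Local Notation sqnorm := (sqnorm mu D).

Lemma sqnorm_eq0_ae (f : T -> R) : measurable_fun D f -> sqnorm f = 0%E ->
  {ae mu, forall x, D x -> f x = 0}.
Proof.
move=> mf f0; have := (ae_eq_integral_abs mu mD (measurable_sqr mf)).1.
have -> : (\int[mu]_(x in D) `|(EFin \o (fun x => (f x ^+ 2)%R)) x| = 0)%E.
  rewrite -[RHS]f0; apply: eq_integral => x _.
  by rewrite gee0_abs// lee_fin sqr_ge0.
move=> /(_ erefl); apply: filterS => x /= /[apply] -[/eqP].
by rewrite sqrf_eq0 => /eqP.
Qed.

(** The positive part of [`|f| - g] is dominated by the distances of [f_ k]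
    to [f] and of [g_ k] to [g]. *)
Lemma ae_abs_le_limit (f_ g_ : nat -> T -> R) (f g : T -> R) :
  (forall k, measurable_fun D (f_ k)) -> (forall k, measurable_fun D (g_ k)) ->
  measurable_fun D f -> measurable_fun D g ->
  (forall k, {ae mu, forall x, D x -> `|f_ k x| <= g_ k x}) ->
  sqnorm (fun x => f_ k x - f x)%R @[k --> \oo] --> 0%E ->
  sqnorm (fun x => g_ k x - g x)%R @[k --> \oo] --> 0%E ->
  {ae mu, forall x, D x -> `|f x| <= g x}.
Proof.
move=> mf_ mg_ mf mg fg fc gc.
pose h x := Num.max (`|f x| - g x) 0.
have mh : measurable_fun D h.
  apply: measurable_maxr => //; apply: measurable_funB => //.
  exact: measurableT_comp.
have mdf k : measurable_fun D (fun x => f_ k x - f x) by exact: measurable_funB.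
have mdg k : measurable_fun D (fun x => g_ k x - g x) by exact: measurable_funB.
have mnf k : measurable_fun D (fun x => `|f_ k x - f x|) by exact: measurableT_comp.
have mng k : measurable_fun D (fun x => `|g_ k x - g x|) by exact: measurableT_comp.
have hk k : (sqnorm h <= 2%:E * sqnorm (fun x => f_ k x - f x)%R +
                        2%:E * sqnorm (fun x => g_ k x - g x)%R)%E.
  have -> : sqnorm (fun x => f_ k x - f x) = sqnorm (fun x => `|f_ k x - f x|).
    by apply: eq_sqnorm => x _; rewrite real_normK ?num_real.
  have -> : sqnorm (fun x => g_ k x - g x) = sqnorm (fun x => `|g_ k x - g x|).
    by apply: eq_sqnorm => x _; rewrite real_normK ?num_real.
  apply: (le_trans _ (sqnormD_le mu mD (mnf k) (mng k))).
  apply: le_sqnorm_ae => //; first exact: measurable_funD.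
  apply: filterS (fg k) => x /[apply] fgx.
  rewrite [leRHS]ger0_norm ?addr_ge0// ger0_norm; last by rewrite le_max lexx orbT.
  rewrite ge_max addr_ge0// andbT.
  have := ler_distD (f_ k x) (f x) 0; rewrite !subr0 distrC.
  have := ler_norm (g_ k x - g x); lra.
have h0 : sqnorm h = 0%E.
  apply/eqP; rewrite eq_le sqnorm_ge0 andbT.
  have c0 : (2%:E * sqnorm (fun x => f_ k x - f x)%R +
        2%:E * sqnorm (fun x => g_ k x - g x)%R)%E @[k --> \oo] --> 0%E.
    rewrite -[X in _ --> X]adde0.
    apply: (@cvgeD _ _ _ _ (fun k => 2%:E * sqnorm (fun x => f_ k x - f x)%R)%E
       (fun k => 2%:E * sqnorm (fun x => g_ k x - g x)%R)%E) => //.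
      by rewrite -[X in _ --> X](mule0 2%:E); apply: cvgeZl.
    by rewrite -[X in _ --> X](mule0 2%:E); apply: cvgeZl.
  by apply: (cvge_to_ge c0); exact: nearW.
have := sqnorm_eq0_ae mh h0; apply: filterS => x /[apply] hx.
by rewrite -subr_le0 -hx /h le_max lexx.
Qed.

(** For 0 <= f <= g one has (g - f)^2 <= g^2 - f^2. *)
Lemma le_sqnorm_eq_ae (f g : T -> R) :
  measurable_fun D f -> measurable_fun D g -> (sqnorm f < +oo)%E ->
  {ae mu, forall x, D x -> 0 <= f x} ->
  {ae mu, forall x, D x -> f x <= g x} -> (sqnorm g <= sqnorm f)%E ->
  {ae mu, forall x, D x -> f x = g x}.
Proof.
move=> mf mg foo f0 fg gf.
have mgf : measurable_fun D (fun x => g x - f x) by exact: measurable_funB.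
have ffin : sqnorm f \is a fin_num by rewrite ge0_fin_numE ?sqnorm_ge0.
have h0 : sqnorm (fun x => g x - f x) = 0%E.
  apply/eqP; rewrite eq_le sqnorm_ge0 andbT -(leeD2lE _ _ ffin) adde0.
  apply: le_trans gf; rewrite -ge0_integralD//; last first.
  - exact: measurable_sqr.
  - by move=> x _; rewrite lee_fin sqr_ge0.
  - exact: measurable_sqr.
  - by move=> x _; rewrite lee_fin sqr_ge0.
  apply: ae_ge0_le_integral => //.
  - by move=> x _; rewrite -EFinD lee_fin addr_ge0 ?sqr_ge0.
  - by apply: emeasurable_funD; exact: measurable_sqr.
  - by move=> x _; rewrite lee_fin sqr_ge0.
  - exact: measurable_sqr.
  apply: filterS2 f0 fg => x f0 fg Dx; rewrite -EFinD lee_fin.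
  have := f0 Dx; have := fg Dx; nra.
have := sqnorm_eq0_ae mgf h0; apply: filterS => x /[apply] /eqP.
by rewrite subr_eq0 => /eqP.
Qed.

End ae_sqnorm.

(** * Stability of weak derivatives along one curve *)
(** Real powers are measurable, and the exponent -1 gives the inverse of
    nonnegative numbers, also at 0. *)
Lemma measurable_fun_div d (T : measurableType d) (R : realType) (D : set T)
    (f g : T -> R) : (forall x, 0 <= g x) ->
  measurable_fun D f -> measurable_fun D g ->
  measurable_fun D (fun x => f x / g x).
Proof.
move=> g0 mf mg; rewrite (_ : (fun _ => _) = (fun x => f x * g x `^ (-1))).
  apply: measurable_funM => //.
  exact: (measurableT_comp (measurable_powR (-1)) mg).
by apply/funext => x; rewrite powR_inv1.
Qed.

Section curve_stability.
Context (R : realType).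
Local Notation I01 := (`]0%R, 1%R[%classic : set (measurableTypeR R)).
Local Notation leb := (@lebesgue_measure R).
Local Notation sqnormI := (@sqnorm _ (measurableTypeR R) R leb I01).

Let mI : measurable I01. Proof. exact: measurable_itv. Qed.

Lemma W11_derivative_ae (u u' w : R -> R) :
  W11_derivative u u' -> measurable_fun I01 w ->
  {ae leb, forall t, I01 t -> u' t = w t} -> W11_derivative u w.
Proof.
move=> [iu iu' Hu] mw uw.
have mu' : measurable_fun I01 u' by apply/measurable_EFinP; exact: measurable_int iu'.
split => //.
  apply/integrableP; split; first exact/measurable_EFinP.
  have /integrableP[_] := iu'; congr (_ < _)%E.
  apply: ae_eq_integral => //.
  - by apply: measurableT_comp => //; exact/measurable_EFinP.
  - by apply: measurableT_comp => //; exact/measurable_EFinP.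
  by apply: filterS uw => t /= /[apply] ->.
move=> phi cphi sphi; rewrite Hu//; congr (- fine _).
have [[mphi _] _] := Ccinfty_bounded_test cphi.
apply: ae_eq_integral => //.
- by apply/measurable_EFinP; exact: measurable_funM.
- by apply/measurable_EFinP; exact: measurable_funM.
by apply: filterS uw => t /= /[apply] ->.
Qed.

(** The domination of [w_ i] by [g_ i * sp] survives if the speed [sp] is
    replaced by the supremum of the quotients [`|w_ i| / g_ i]: it is the
    smallest possible choice, and unlike [sp] it is measurable by
    construction. *)
Lemma measurable_speed_minorant (sp : R -> R) (g_ w_ : nat -> R -> R) :
  (forall t, 0 <= sp t) ->
  (\int[leb]_(t in `[0%R, 1%R]) ((sp t) ^+ 2)%:E < +oo)%E ->
  (forall i t, 0 <= g_ i t) ->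
  (forall i, measurable_fun I01 (g_ i)) -> (forall i, measurable_fun I01 (w_ i)) ->
  (forall i, {ae leb, forall t, 0 <= t <= 1 -> `|w_ i t| <= g_ i t * sp t}) ->
  exists s : R -> R,
    [/\ forall t, 0 <= s t, measurable_fun I01 s, (sqnormI s < +oo)%E,
        {ae leb, forall t, I01 t -> s t <= sp t} &
        forall i, {ae leb, forall t, I01 t -> `|w_ i t| <= g_ i t * s t}].
Proof.
move=> sp0 spoo g0 mg mw wgsp.
pose r i t := `|w_ i t| / g_ i t.
have r0 i t : 0 <= r i t by rewrite divr_ge0.
pose s t := fine (esups (fun i => (r i t)%:E) 0%N).
have sup0 t : (0 <= esups (fun i => (r i t)%:E) 0%N)%E.
  by apply: le_ereal_sup_tmp; exists (r 0%N t)%:E; [exists 0%N|rewrite lee_fin].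
have s0 t : 0 <= s t by rewrite fine_ge0.
have ms : measurable_fun I01 s.
  apply: (measurableT_comp (f := fine)); first exact: fine_measurable.
  apply: (@measurable_fun_esups _ _ _ _ (fun i t => (r i t)%:E)) => i.
  apply/measurable_EFinP; apply: measurable_fun_div => //.
    by apply: measurableT_comp => //; exact: mw.
  exact: mg.
have rs : {ae leb, forall t, I01 t -> s t <= sp t /\ forall i, `|w_ i t| <= g_ i t * s t}.
  have := ae_foralln wgsp; apply: filterS => t wt.
  rewrite /= in_itv/= => /andP[/ltW t0 /ltW t1].
  have {}wt i : `|w_ i t| <= g_ i t * sp t by apply: wt; rewrite t0.
  have rsp i : r i t <= sp t.
    have := g0 i t; rewrite le_eqVlt => /predU1P[gi0|gi0].
      by rewrite /r -gi0 invr0 mulr0.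
    by rewrite /r ler_pdivrMr// mulrC.
  have ssp : (esups (fun i => (r i t)%:E) 0%N <= (sp t)%:E)%E.
    by apply: ge_ereal_sup => _ [i _ <-]; rewrite lee_fin.
  have sfin : esups (fun i => (r i t)%:E) 0%N \is a fin_num.
    by rewrite ge0_fin_numE// (le_lt_trans ssp)// ltry.
  split; first by rewrite -lee_fin fineK.
  move=> i; have rsi : r i t <= s t.
    by rewrite -lee_fin /s fineK//; apply: ereal_sup_ubound; exists i.
  have := g0 i t; rewrite le_eqVlt => /predU1P[gi0|gi0].
    by have := wt i; rewrite -gi0 !mul0r.
  by move: rsi; rewrite /r ler_pdivrMr// mulrC.
exists s; split => //.
- apply: le_lt_trans spoo; apply: le_lower_integral => //.
  + by move=> t; rewrite /= !in_itv/= => /andP[/ltW -> /ltW ->].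
  + exact: measurable_sqr.
  + by move=> t _; rewrite lee_fin sqr_ge0.
  + by move=> t _; rewrite lee_fin sqr_ge0.
  apply: filterS rs => t /[apply] -[ssp _].
  by rewrite lee_fin ler_sqr ?nnegrE.
- by apply: filterS rs => t /[apply] -[].
- by move=> i; apply: filterS rs => t /[apply] -[].
Qed.


(** Where [s] vanishes so does [w], and the convention that the quotient is
    then 0 keeps the factorization and the bound true. *)
Lemma factor_through_speed (s g w : R -> R) :
  (forall t, 0 <= s t) -> (forall t, 0 <= g t) ->
  measurable_fun I01 s -> measurable_fun I01 w ->
  {ae leb, forall t, I01 t -> `|w t| <= g t * s t} ->
  [/\ measurable_fun I01 (fun t => w t / s t),
      {ae leb, forall t, I01 t -> w t = w t / s t * s t} &
      {ae leb, forall t, I01 t -> `|w t / s t| <= g t}].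
Proof.
move=> s0 g0 ms mw wgs; split; first exact: measurable_fun_div.
- apply: filterS wgs => t /[apply]; have [->|st] := eqVneq (s t) 0.
    by rewrite !mulr0 normr_le0 => /eqP.
  by rewrite divfK.
- apply: filterS wgs => t /[apply]; have [->|st] := eqVneq (s t) 0.
    by rewrite invr0 !mulr0 normr0.
  by rewrite normrM normfV (ger0_norm (s0 t)) ler_pdivrMr// lt_def st s0.
Qed.

(** With [w_ i = q_ i * s], the functions [q_ i] are bounded in L^2 by the
    [g_ i], but need not converge.  The midpoint-stable sets [C k] collect
    the triples (u, q, g) that satisfy the same relations and are
    1/(k+1)-close to the limits in the first and third components; among them,
    almost minimizers of the norm of q converge strongly, and all the
    relations pass to that limit. *)
Lemma weak_derivative_limit (u g : R -> R) (u_ g_ w_ : nat -> R -> R)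
    (sp : R -> R) :
  measurable_fun I01 u -> (sqnormI u < +oo)%E ->
  measurable_fun I01 g -> (sqnormI g < +oo)%E ->
  (forall i, measurable_fun I01 (u_ i)) -> (forall i, measurable_fun I01 (g_ i)) ->
  (forall i t, 0 <= g_ i t) -> (forall t, 0 <= g t) -> (forall t, 0 <= sp t) ->
  (\int[leb]_(t in `[0%R, 1%R]) ((sp t) ^+ 2)%:E < +oo)%E ->
  (forall i, W11_derivative (u_ i) (w_ i)) ->
  (forall i, {ae leb, forall t, 0 <= t <= 1 -> `|w_ i t| <= g_ i t * sp t}) ->
  sqnormI (fun t => u_ i t - u t)%R @[i --> \oo] --> 0%E ->
  sqnormI (fun t => g_ i t - g t)%R @[i --> \oo] --> 0%E ->
  exists2 w, W11_derivative u w &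
    {ae leb, forall t, 0 <= t <= 1 -> `|w t| <= g t * sp t}.
Proof.
move=> mu uoo mg goo mu_ mg_ g_0 g0 sp0 spoo Ww wgsp ucvg gcvg.
have mw i : measurable_fun I01 (w_ i).
  by have [_ iw _] := Ww i; apply/measurable_EFinP; exact: measurable_int iw.
have [s [s0 ms soo ssp wgs]] := measurable_speed_minorant sp0 spoo g_0 mg_ mw wgsp.
pose q_ i t := w_ i t / s t.
have qP i := factor_through_speed s0 (g_0 i) ms (mw i) (wgs i).
have mq_ i : measurable_fun I01 (q_ i) by have [] := qP i.
have qg i : {ae leb, forall t, I01 t -> `|q_ i t| <= g_ i t} by have [] := qP i.
have Wq i : W11_derivative (u_ i) (fun t => q_ i t * s t).
  apply: (W11_derivative_ae (Ww i)); first exact: measurable_funM.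
  by have [] := qP i.
pose X := ((R -> R) * (R -> R) * (R -> R))%type.
pose C (k : nat) : set X := [set x : X | [/\
  [/\ measurable_fun I01 x.1.1, measurable_fun I01 x.1.2 & measurable_fun I01 x.2],
  W11_derivative x.1.1 (fun t => x.1.2 t * s t),
  {ae leb, forall t, I01 t -> `|x.1.2 t| <= x.2 t},
  (sqnormI (fun t => x.1.1 t - u t)%R <= k.+1%:R^-1%:E)%E &
  (sqnormI (fun t => x.2 t - g t)%R <= k.+1%:R^-1%:E)%E]].
pose avg (a b : R -> R) t := 2^-1 * (a t + b t).
pose mid (x y : X) : X := (avg x.1.1 y.1.1, avg x.1.2 y.1.2, avg x.2 y.2).
pose N (x : X) := fine (sqnormI x.1.2).
pose dist (x y : X) := fine (sqnormI (fun t => x.1.2 t - y.1.2 t)%R).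
have invle i j : (i <= j)%N -> (j.+1%:R^-1 <= i.+1%:R^-1 :> R).
  by move=> ij; rewrite lef_pV2 ?posrE ?ltr0n// ler_nat ltnS.
have Cq k x : C k x -> (sqnormI x.1.2 < +oo)%E.
  move=> [[_ mx mx2] _ qx _ xg].
  apply: (@le_lt_trans _ _ (sqnormI x.2)).
    apply: le_sqnorm_ae => //; apply: filterS qx => t /[apply] h.
    by rewrite (le_trans h)// ler_norm.
  apply: (sqnorm_lty_limit mI mx2 mg goo).
  by rewrite (le_lt_trans xg)// ltry.
have Cfin k x : C k x -> sqnormI x.1.2 \is a fin_num.
  by move=> /Cq; rewrite ge0_fin_numE// sqnorm_ge0.
have mavg (a b : R -> R) : measurable_fun I01 a -> measurable_fun I01 b ->
    measurable_fun I01 (avg a b).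
  by move=> ma mb; apply: measurable_funM => //; exact: measurable_funD.
have avg_close (a b c : R -> R) (e : R) :
    measurable_fun I01 a -> measurable_fun I01 b -> measurable_fun I01 c ->
    (sqnormI (fun t => a t - c t)%R <= e%:E)%E ->
    (sqnormI (fun t => b t - c t)%R <= e%:E)%E ->
    (sqnormI (fun t => avg a b t - c t)%R <= e%:E)%E.
  move=> ma mb mc ae be.
  have := sqnorm_mid leb mI (measurable_funB ma mc) (measurable_funB mb mc).
  have <- : sqnormI (fun t => avg a b t - c t)%R =
      sqnormI (fun t => 2^-1 * ((a \- c) t + (b \- c) t))%R.
    by apply: eq_sqnorm => t _; rewrite /avg/=; congr (_ ^+ 2); field.
  move=> /le_trans; apply.
  rewrite (splitr e) mulrC -mulrDr EFinM lee_pmul2l ?lte_fin ?invr_gt0//.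
  by rewrite EFinD leeD.
have [] := @almost_minimizers_cauchy R X C mid N dist
  (fine (2%:E * 1 + 2%:E * sqnormI g)%E).
- move=> i j ij x [mx Wx qx ux gx]; split=> //.
    by rewrite (le_trans ux)// lee_fin invle.
  by rewrite (le_trans gx)// lee_fin invle.
- move=> k x y [[mx1 mx2 mx3] Wx qx ux gx] [[my1 my2 my3] Wy qy uy gy].
  split=> /=.
  + by split; exact: mavg.
  + have := W11_derivative_mid Wx Wy; congr (W11_derivative _ _).
    by apply/funext => t; rewrite /avg; ring.
  + apply: filterS2 qx qy => t qx qy It; have := qx It; have := qy It.
    rewrite /avg normrM gtr0_norm// => h1 h2.
    by rewrite ler_pM2l// (le_trans (ler_normD _ _))// lerD.
  + exact: avg_close.
  + exact: avg_close.
- by move=> x _; rewrite fine_ge0// sqnorm_ge0.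
- move=> k.
  have k0 : 0 < k.+1%:R^-1 :> R by rewrite invr_gt0 ltr0n.
  have [K1 HK1] := (cvg0_eP (fun i => sqnorm_ge0 _ _ _)).1 ucvg _ k0.
  have [K2 HK2] := (cvg0_eP (fun i => sqnorm_ge0 _ _ _)).1 gcvg _ k0.
  pose i := maxn K1 K2.
  have Ci : C k (u_ i, q_ i, g_ i).
    by split => //=; [exact: (HK1 _ (leq_maxl _ _))|exact: (HK2 _ (leq_maxr _ _))].
  exists (u_ i, q_ i, g_ i) => //; rewrite /N/=.
  apply: fine_le; first exact: Cfin Ci.
    by rewrite ge0_fin_numE ?adde_ge0 ?mule_ge0 ?sqnorm_ge0// mule1
      lte_add_pinfty ?ltry// lte_mul_pinfty.
  apply: (@le_trans _ _ (sqnormI (fun t => (g_ i t - g t) + g t)%R)).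
    apply: le_sqnorm_ae => //.
      by apply: measurable_funD => //; exact: measurable_funB.
    by apply: filterS (qg i) => t /[apply] h; rewrite subrK (le_trans h)// ler_norm.
  apply: (le_trans (sqnormD_le leb mI (measurable_funB (mg_ i) mg) mg)).
  rewrite leeD2r// lee_pmul2l//.
  have [_ _ _ _ /= gi] := Ci; apply: (le_trans gi).
  by rewrite lee_fin invf_le1 ?ltr0n// ler1n.
- move=> x y Cx Cy.
  have [[_ mx _] _ _ _ _] := Cx; have [[_ my _] _ _ _ _] := Cy.
  have fx := Cfin _ _ Cx; have fy := Cfin _ _ Cy.
  have par := sqnorm_parallelogram leb mI mx my.
  have f2 : (2%:E * sqnormI x.1.2 + 2%:E * sqnormI y.1.2)%E \is a fin_num.
    by rewrite fin_numD !fin_numM.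
  have : (sqnormI (fun t => x.1.2 t + y.1.2 t)%R +
      sqnormI (fun t => x.1.2 t - y.1.2 t)%R)%E \is a fin_num by rewrite par.
  rewrite fin_numD => /andP[fD fB].
  rewrite /dist /N /mid/= /avg sqnormZ//; last exact: measurable_funD.
  move: fx fy fD fB par.
  move: (sqnormI x.1.2) (sqnormI y.1.2) (sqnormI (fun t => x.1.2 t + y.1.2 t)%R)
    (sqnormI (fun t => x.1.2 t - y.1.2 t)%R).
  move=> [a||] [b||] [c||] [e||]// _ _ _ _ /= [par].
  have -> : 4 * (2^-1 ^+ 2 * c) = c by field.
  by rewrite -par addrC addrK.
move=> x_ [Cx _ cauchy].
pose qk k := (x_ k).1.2.
have mqk k : measurable_fun I01 (qk k) by have [[]] := Cx k.
have [q [mq qcvg]] : exists q : R -> R, measurable_fun I01 q /\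
    sqnormI (fun t => qk k t - q t)%R @[k --> \oo] --> 0%E.
  apply: (@sqnorm_complete _ _ _ leb I01 mI qk) => // e e0; have [K HK] := cauchy e e0.
  exists K => i j Ki Kj; have := HK i j Ki Kj; rewrite /dist -lee_fin fineK//.
  rewrite ge0_fin_numE ?sqnorm_ge0//.
  by apply: sqnormB_lty => //; [exact: mqk|exact: mqk|exact: (Cq _ _ (Cx i))|exact: (Cq _ _ (Cx j))].
have qoo : (sqnormI q < +oo)%E.
  have [K HK] := (cvg0_eP (fun i => sqnorm_ge0 _ _ _)).1 qcvg _ ltr01.
  apply: (sqnorm_lty_limit mI mq (mqk K)); first exact: (Cq _ _ (Cx K)).
  by rewrite sqnormB (le_lt_trans (HK K _))// ltry.
have close (a : nat -> R -> R) (b : R -> R) :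
    (forall k, sqnormI (fun t => a k t - b t)%R <= k.+1%:R^-1%:E)%E ->
    sqnormI (fun t => a k t - b t)%R @[k --> \oo] --> 0%E.
  move=> ab; apply/cvg0_eP => [k|e e0]; first exact: sqnorm_ge0.
  have [K _ HK] := near_infty_natSinv_lt (PosNum e0).
  exists K => k /HK /= ke; apply: (le_trans (ab k)).
  by rewrite lee_fin ltW.
have uk : sqnormI (fun t => (x_ k).1.1 t - u t)%R @[k --> \oo] --> 0%E.
  by apply: close => k; have [] := Cx k.
have gk : sqnormI (fun t => (x_ k).2 t - g t)%R @[k --> \oo] --> 0%E.
  by apply: close => k; have [] := Cx k.
exists (fun t => q t * s t).
  apply: (W11_derivative_limit mu uoo mq qoo ms soo _ mqk _ uk qcvg) => k.
    by have [[]] := Cx k.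
  by have [] := Cx k.
have qleg : {ae leb, forall t, I01 t -> `|q t| <= g t}.
  apply: (ae_abs_le_limit mI mqk _ mq mg _ qcvg gk) => k.
    by have [[]] := Cx k.
  by have [] := Cx k.
(* the conclusion concerns [0, 1], the construction took place in ]0, 1[ *)
have end_null (a : R) : {ae leb, forall t : measurableTypeR R, t != a}.
  exists [set a]; split; [exact: measurable_set1|exact: lebesgue_measure_set1|].
  by move=> t /= /negP; rewrite negbK => /eqP.
move: (end_null 0) (end_null 1) => n0 n1.
have inI : {ae leb, forall t : measurableTypeR R, 0 <= t <= 1 -> I01 t}.
  apply: filterS2 n0 n1 => t t0 t1 /andP[t0' t1'].
  by rewrite /= in_itv/= !lt_def t0 t0' eq_sym t1 t1'.
apply: filterS3 qleg ssp inI => t h1 h2 h3 /h3 It.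
rewrite normrM (ger0_norm (s0 t)).
by apply: ler_pM => //; [exact: h1|exact: h2].
Qed.

End curve_stability.

(** * Stability of weak upper gradients *)
Lemma nneseries_cvg0 (R : realType) (F : nat -> \bar R) :
  (forall i, 0 <= F i)%E -> (\sum_(i <oo) F i < +oo)%E ->
  F i @[i --> \oo] --> 0%E.
Proof.
move=> F0 Foo; have tail := @nneseries_tail_cvg _ F xpredT Foo (fun i _ => F0 i).
apply: (@squeeze_cvge _ _ _ _ (cst 0%E) _ _ _ _ _ tail); last exact: cvg_cst.
apply: nearW => i; rewrite F0/=.
apply: (le_trans _ (@nneseries_lim_ge _ _ xpredT i i.+1 _)) => //.
by rewrite big_nat1.
Qed.

Section wug_limit.
Context (R : realType) (n : nat).
Variable mu : {measure set (borelRn R n) -> \bar R}.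
Local Notation sqnormR := (@sqnorm _ (borelRn R n) R mu setT).
Local Notation I01 := (`]0%R, 1%R[%classic : set (measurableTypeR R)).
Local Notation leb := (@lebesgue_measure R).
Local Notation sqnormI := (@sqnorm _ (measurableTypeR R) R leb I01).

Section plan.
Variables (pi : probability (borelC R n) R) (C : R).
Hypothesis C0 : 0 < C.
Hypothesis piC : forall t : R, 0 <= t <= 1 ->
  forall A : set (borelRn R n), measurable A ->
    (pushforward pi (@evalC R n t) A <= C%:E * mu A)%E.

Lemma ae_sqnorm_curve_lty (f : 'rV[R]_n -> R) :
  @measurable_fun _ _ (borelRn R n) R setT f -> (sqnormR f < +oo)%E ->
  {ae pi, forall g : curve R n, (sqnormI (f \o g) < +oo)%E}.
Proof.
move=> mf foo; have mS := measurable_sqnorm_curve mf.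
have iS : pi.-integrable setT (fun g : borelC R n => sqnormI (f \o (g : curve R n))).
  apply/integrableP; split => //.
  under eq_integral do rewrite gee0_abs ?sqnorm_ge0//.
  apply: (le_lt_trans (integral_sqnorm_curve_le mf C0 piC)).
  by rewrite lte_mul_pinfty// ?lee_fin ?ltW.
have := integrable_ae measurableT iS; apply: filterS => g /(_ I).
by rewrite ge0_fin_numE// sqnorm_ge0.
Qed.

(** Summability of the distances in L^2(mu) gives, through the test plan,
    summability of the distances along almost every curve. *)
Lemma ae_sqnorm_curve_cvg (f_ : nat -> 'rV[R]_n -> R) (f : 'rV[R]_n -> R) :
  (forall i, @measurable_fun _ _ (borelRn R n) R setT (f_ i)) ->
  @measurable_fun _ _ (borelRn R n) R setT f ->
  (forall i, (sqnormR (fun x => f_ i x - f x)%R <= (C^-1 / (2 ^ i.+1)%:R)%:E)%E) ->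
  {ae pi, forall g : curve R n,
     sqnormI (fun t => f_ i (g t) - f (g t))%R @[i --> \oo] --> 0%E}.
Proof.
move=> mf_ mf small.
have md i : @measurable_fun _ _ (borelRn R n) R setT (fun x => f_ i x - f x).
  exact: measurable_funB.
have := @summable_ae _ (borelC R n) R pi setT measurableT
  (fun i g => sqnormI ((fun x => f_ i x - f x) \o (g : curve R n))).
move=> /(_ (fun i => measurable_sqnorm_curve (md i))) H.
have {}H := H (fun i x _ => sqnorm_ge0 _ _ _).
have : forall i, (\int[pi]_(g in setT) sqnormI ((fun x => f_ i x - f x)%R \o (g : curve R n))
    <= (1 / (2 ^ i.+1)%:R)%:E)%E.
  move=> i; apply: (le_trans (integral_sqnorm_curve_le (md i) C0 piC)).
  apply: (@le_trans _ _ (C%:E * (C^-1 / (2 ^ i.+1)%:R)%:E)%E).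
    by rewrite lee_pmul2l ?lte_fin.
  by rewrite -EFinM mulrA divff ?gt_eqF.
move=> /H; apply: filterS => g /(_ I) Hg.
by apply: nneseries_cvg0 => // i; exact: sqnorm_ge0.
Qed.

End plan.

(** A fast subsequence converges along almost every curve of a given test
    plan, and there the stability of weak derivatives applies; the
    subsequence may depend on the plan. *)
Lemma is_wug_limit (f G : 'rV[R]_n -> R) (f_ G_ : nat -> 'rV[R]_n -> R) :
  f \in Lfun mu 2%:E -> G \in Lfun mu 2%:E ->
  (forall x, 0 <= G x) -> (forall i x, 0 <= G_ i x) ->
  (forall i, is_wug mu (f_ i) (G_ i)) ->
  sqnormR (fun x => f_ i x - f x)%R @[i --> \oo] --> 0%E ->
  sqnormR (fun x => G_ i x - G x)%R @[i --> \oo] --> 0%E ->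
  is_wug mu f G.
Proof.
move=> Lf LG G0 G_0 wug fc Gc.
split => //; first exact: aeW.
move=> pi plan; have [acpi _ [C C0 piC]] := plan.
have /Lfun2P[mf foo] := Lf; have /Lfun2P[mG Goo] := LG.
have mf_ i : @measurable_fun _ _ (borelRn R n) R setT (f_ i).
  by have [/Lfun2P[]] := wug i.
have mG_ i : @measurable_fun _ _ (borelRn R n) R setT (G_ i).
  by have [_ /Lfun2P[]] := wug i.
have /choice[k kP] (j : nat) : exists k,
    (sqnormR (fun x => f_ k x - f x)%R <= (C^-1 / (2 ^ j.+1)%:R)%:E)%E /\
    (sqnormR (fun x => G_ k x - G x)%R <= (C^-1 / (2 ^ j.+1)%:R)%:E)%E.
  have e0 : 0 < C^-1 / (2 ^ j.+1)%:R.
    by rewrite divr_gt0 ?invr_gt0// ltr0n expn_gt0.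
  have [K1 HK1] := (cvg0_eP (fun i => sqnorm_ge0 _ _ _)).1 fc _ e0.
  have [K2 HK2] := (cvg0_eP (fun i => sqnorm_ge0 _ _ _)).1 Gc _ e0.
  by exists (maxn K1 K2); rewrite HK1 ?leq_maxl// HK2 ?leq_maxr.
have af := ae_sqnorm_curve_cvg C0 piC (fun j => mf_ (k j)) mf (fun j => (kP j).1).
have aG := ae_sqnorm_curve_cvg C0 piC (fun j => mG_ (k j)) mG (fun j => (kP j).2).
have bf := ae_sqnorm_curve_lty C0 piC mf foo.
have bG := ae_sqnorm_curve_lty C0 piC mG Goo.
have aw : {ae pi, forall g : curve R n, forall j,
    exists2 u' : R -> R, W11_derivative (f_ (k j) \o g) u' &
      {ae leb, forall t, 0 <= t <= 1 -> `|u' t| <= G_ (k j) (g t) * speed g t}}.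
  by apply: ae_foralln => j; have [_ _ _ /(_ pi plan)] := wug (k j).
have FF : Filter (almost_everywhere pi) := ae_filter_ringOfSetsType pi.
have acw := @filterI _ _ FF _ _ acpi aw.
have afG := @filterI _ _ FF _ _ af aG; have bfG := @filterI _ _ FF _ _ bf bG.
have := @filterI _ _ FF _ _ acw (@filterI _ _ FF _ _ afG bfG).
apply: (@filterS _ _ FF) => g [[[_ kin] gw] [[gf gG] [gfoo gGoo]]].
have /choice[w wP] : forall j, exists w : R -> R, W11_derivative (f_ (k j) \o g) w /\
      {ae leb, forall t, 0 <= t <= 1 -> `|w t| <= G_ (k j) (g t) * speed g t}.
  by move=> j; have [w] := gw j; exists w.
apply: (@weak_derivative_limit R (f \o g) (G \o g) (fun j => f_ (k j) \o g)
  (fun j => G_ (k j) \o g) w (speed g)) => //.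
- exact: measurable_along_curve.
- exact: measurable_along_curve.
- by move=> i; exact: measurable_along_curve.
- by move=> i; exact: measurable_along_curve.
- by move=> i t; exact: G_0.
- by move=> t; exact: G0.
- by move=> t; exact: enorm_ge0.
- by move=> j; have [] := wP j.
- by move=> j; have [] := wP j.
Qed.

End wug_limit.

(** * Square-integrable vector fields *)
Section enorm_triangle.
Context (R : realType) (n : nat).
Implicit Types x y : 'rV[R]_n.

(** Cauchy-Schwarz, from the square of the vector enorm y * x - enorm x * y. *)
Lemma dot_le_enorm x y : \sum_(i < n) x 0 i * y 0 i <= enorm x * enorm y.
Proof.
have ax := enorm_ge0 x; have ay := enorm_ge0 y.
have z0 z w : enorm z = 0 -> \sum_(i < n) z 0 i * w i = 0 :> R.
  move=> ez; rewrite big1// => i _.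
  by have := coord_le_enorm z i; rewrite ez normr_le0 => /eqP ->; rewrite mul0r.
have [ex|ex] := eqVneq (enorm x) 0; first by rewrite z0// ex mul0r.
have [ey|ey] := eqVneq (enorm y) 0.
  under eq_bigr do rewrite mulrC.
  by rewrite z0// ey mulr0.
have xy0 : 0 < enorm x * enorm y by rewrite mulr_gt0 ?lt_def ?ex ?ey ?ax ?ay.
have : 0 <= \sum_(i < n) (enorm y * x 0 i - enorm x * y 0 i) ^+ 2.
  by apply: sumr_ge0 => i _; exact: sqr_ge0.
have -> : \sum_(i < n) (enorm y * x 0 i - enorm x * y 0 i) ^+ 2 =
    2 * (enorm x * enorm y) * (enorm x * enorm y - \sum_(i < n) x 0 i * y 0 i).
  transitivity (enorm y ^+ 2 * enorm x ^+ 2 + enorm x ^+ 2 * enorm y ^+ 2 -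
      2 * (enorm x * enorm y) * \sum_(i < n) x 0 i * y 0 i); last by ring.
  rewrite {1}(enorm_sqr x) {2}(enorm_sqr y) !mulr_sumr -big_split/= -sumrB.
  by apply: eq_bigr => i _; ring.
by rewrite pmulr_rge0 ?subr_ge0// mulr_gt0.
Qed.

Lemma enorm_dist x y : `|enorm x - enorm y| <= enorm (x - y).
Proof.
rewrite -ler_sqr ?nnegrE ?enorm_ge0// real_normK ?num_real//.
have -> : enorm (x - y) ^+ 2 =
    enorm x ^+ 2 + enorm y ^+ 2 - 2 * \sum_(i < n) x 0 i * y 0 i.
  rewrite !enorm_sqr mulr_sumr -big_split/= -sumrB.
  by apply: eq_bigr => i _; rewrite !mxE; ring.
by have := dot_le_enorm x y; nra.
Qed.

End enorm_triangle.

Section L2_fields.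
Context (R : realType) (n : nat).
Variable mu : {measure set (borelRn R n) -> \bar R}.
Local Notation sqnormR := (@sqnorm _ (borelRn R n) R mu setT).
Local Notation mfunR := (@measurable_fun _ _ (borelRn R n) R setT).
Implicit Types v w : 'rV[R]_n -> 'rV[R]_n.

Definition vsqnorm v := sqnormR (fun x => enorm (v x)).

Definition coord_measurable v := forall i, mfunR (fun x => v x 0 i).

Lemma vsqnormE v : coord_measurable v ->
  vsqnorm v = (\sum_(i < n) sqnormR (fun x => v x 0%R i))%E.
Proof.
move=> mv; rewrite /vsqnorm /sqnorm -ge0_integral_sum//.
- by apply: eq_integral => x _; rewrite enorm_sqr sumEFin.
- by move=> i; apply/measurable_EFinP; exact: measurable_funX.
- by move=> i x _; rewrite lee_fin sqr_ge0.
Qed.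

Lemma measurable_enorm v : coord_measurable v -> mfunR (fun x => enorm (v x)).
Proof.
move=> mv; have ms : mfunR (fun x => \sum_(i < n) v x 0 i ^+ 2).
  by apply: measurable_sum => i; exact: measurable_funX.
exact: (measurableT_comp (continuous_measurable_fun (@sqrt_continuous R)) ms).
Qed.

Lemma L2vec_measurable v : L2vec mu v -> coord_measurable v.
Proof. by move=> Lv i; have /Lfun2P[] := Lv i. Qed.

Lemma L2vec_lty v : L2vec mu v -> (vsqnorm v < +oo)%E.
Proof.
move=> Lv; rewrite vsqnormE; last exact: L2vec_measurable.
by apply: lte_sum_pinfty => i _; have /Lfun2P[] := Lv i.
Qed.

Lemma coord_measurableB v w : coord_measurable v -> coord_measurable w ->
  coord_measurable (fun x => v x - w x).
Proof.
move=> mv mw i; rewrite (_ : (fun _ => _) = (fun x => v x 0 i - w x 0 i)).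
  exact: measurable_funB.
by apply/funext => x; rewrite !mxE.
Qed.

Lemma L2vecB v w : L2vec mu v -> L2vec mu w -> L2vec mu (fun x => v x - w x).
Proof.
move=> Lv Lw i; have /Lfun2P[mv vi] := Lv i; have /Lfun2P[mw wi] := Lw i.
rewrite (_ : (fun _ => _) = (fun x => v x 0 i - w x 0 i)).
  by apply/Lfun2P; split; [exact: measurable_funB|exact: sqnormB_lty].
by apply/funext => x; rewrite !mxE.
Qed.

Lemma coord_measurable_mid v w : coord_measurable v -> coord_measurable w ->
  coord_measurable (fun x => 2^-1 *: v x + 2^-1 *: w x).
Proof.
move=> mv mw i.
rewrite (_ : (fun _ => _) = (fun x => 2^-1 * v x 0 i + 2^-1 * w x 0 i)).
  by apply: measurable_funD; exact: measurable_funM.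
by apply/funext => x; rewrite !mxE.
Qed.

Lemma vsqnorm_parallelogram v w : coord_measurable v -> coord_measurable w ->
  (vsqnorm (fun x => v x - w x)%R +
   4%:E * vsqnorm (fun x => 2^-1 *: v x + 2^-1 *: w x)%R =
   2%:E * vsqnorm v + 2%:E * vsqnorm w)%E.
Proof.
move=> mv mw; rewrite !vsqnormE//; last 2 first.
- exact: coord_measurable_mid.
- exact: coord_measurableB.
rewrite !ge0_sume_distrr -?big_split/=; try by move=> i _; exact: sqnorm_ge0.
apply: eq_bigr => i _; rewrite -sqnorm_parallelogram//= addeC; congr (_ + _)%E.
  rewrite -(_ : (2 ^+ 2)%:E = 4%:E :> \bar R)%E; last by rewrite expr2 -natrM.
  rewrite -sqnormZ//; last exact: coord_measurable_mid.
  by apply: eq_sqnorm => x _; rewrite !mxE; congr (_ ^+ 2); field.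
by apply: eq_sqnorm => x _; rewrite !mxE.
Qed.

Lemma enorm_cvg (v_ : nat -> 'rV[R]_n -> 'rV[R]_n) v :
  (forall k, coord_measurable (v_ k)) -> coord_measurable v ->
  vsqnorm (fun x => v_ k x - v x) @[k --> \oo] --> 0%E ->
  sqnormR (fun x => enorm (v_ k x) - enorm (v x))%R @[k --> \oo] --> 0%E.
Proof.
move=> mv_ mv; apply: squeeze_cvge (cvg_cst _); apply: nearW => k.
rewrite sqnorm_ge0/=; apply: le_sqnorm => //.
- by apply: measurable_funB; exact: measurable_enorm.
- by apply: measurable_enorm; exact: coord_measurableB.
by move=> x _; rewrite [leRHS]ger0_norm ?enorm_ge0// enorm_dist.
Qed.

(** Coordinates are dominated by the norm, so completeness is inherited from
    the scalar case coordinate by coordinate. *)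
Lemma vsqnorm_complete (v_ : nat -> 'rV[R]_n -> 'rV[R]_n) :
  (forall k, L2vec mu (v_ k)) ->
  (forall e : R, 0 < e -> exists K, forall i j, (K <= i)%N -> (K <= j)%N ->
     (vsqnorm (fun x => v_ i x - v_ j x)%R <= e%:E)%E) ->
  exists2 v, L2vec mu v & vsqnorm (fun x => v_ k x - v x)%R @[k --> \oo] --> 0%E.
Proof.
move=> Lv cv; have mv_ k := L2vec_measurable (Lv k).
have le_coord v i : coord_measurable v ->
    (sqnormR (fun x => v x 0%R i) <= vsqnorm v)%E.
  move=> mv; apply: le_sqnorm => //; first exact: measurable_enorm.
  by move=> x _; rewrite [leRHS]ger0_norm ?enorm_ge0// coord_le_enorm.
have /choice[w wP] (i : 'I_n) : exists w : 'rV[R]_n -> R, mfunR w /\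
    sqnormR (fun x => v_ k x 0 i - w x)%R @[k --> \oo] --> 0%E.
  apply: (@sqnorm_complete _ (borelRn R n) R mu setT measurableT
    (fun k x => v_ k x 0 i)) => [k|e e0]; first exact: mv_.
  have [K HK] := cv e e0; exists K => a b Ka Kb; apply: le_trans (HK a b Ka Kb).
  apply: le_trans (le_coord _ i (coord_measurableB (mv_ a) (mv_ b))).
  by rewrite le_eqVlt; apply/orP; left; apply/eqP; apply: eq_sqnorm => x _; rewrite !mxE.
pose v x := \row_i w i x.
have vE i : (fun x => v x 0 i) = w i by apply/funext => x; rewrite mxE.
exists v.
  move=> i; rewrite vE; apply/Lfun2P; split; first by have [] := wP i.
  have [mw cw] := wP i.
  have [K HK] := (cvg0_eP (fun i => sqnorm_ge0 _ _ _)).1 cw _ ltr01.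
  have /Lfun2P[mvK vKoo] := Lv K i.
  apply: (sqnorm_lty_limit measurableT mw mvK vKoo).
  by rewrite sqnormB (le_lt_trans (HK K _))// ltry.
have mv : coord_measurable v by move=> i; rewrite vE; have [] := wP i.
have -> : (fun k => vsqnorm (fun x => v_ k x - v x)%R) =
    (fun k => \sum_(i < n) sqnormR (fun x => v_ k x 0 i - w i x)%R)%E.
  apply/funext => k; rewrite vsqnormE; last exact: coord_measurableB.
  by apply: eq_bigr => i _; apply: eq_sqnorm => x _; rewrite !mxE.
rewrite -[X in _ --> X](_ : (\sum_(i < n) 0 = 0)%E); last by rewrite big1.
apply: cvg_nnesum => [i _|i _]; first by apply: nearW => k; exact: sqnorm_ge0.
by have [_] := wP i.
Qed.

End L2_fields.

(** * G-gradients and the relaxed energy *)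
Section Gstructure.
Context (R : realType) (n : nat).
Variable mu : {measure set (borelRn R n) -> \bar R}.
Variable V : set ('rV[R]_n -> R).
Variable nabla : ('rV[R]_n -> R) -> 'rV[R]_n -> 'rV[R]_n.
Hypothesis GS : G_structure mu V nabla.
Local Notation sqnormR := (@sqnorm _ (borelRn R n) R mu setT).
Local Notation mfunR := (@measurable_fun _ _ (borelRn R n) R setT).
Local Notation vsqnorm := (vsqnorm mu).
Local Notation E := (lsc_envelope mu (energyG mu V nabla)).
Implicit Types (f g h : 'rV[R]_n -> R) (w : 'rV[R]_n -> 'rV[R]_n).

Lemma V_Lfun f : V f -> f \in Lfun mu 2%:E.
Proof. by move=> /(GS_V_W12 GS)[]. Qed.

Lemma nabla_measurable f : V f -> coord_measurable (nabla f).
Proof. by move=> /(GS_nabla_L2 GS); exact: L2vec_measurable. Qed.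

Lemma energyG_V f : V f -> energyG mu V nabla f = (2^-1%:E * vsqnorm (nabla f))%E.
Proof. by move=> Vf; rewrite /energyG asboolT. Qed.

Lemma energyG_notV f : ~ V f -> energyG mu V nabla f = +oo%E.
Proof. by move=> Vf; rewrite /energyG asboolF. Qed.

Definition midpoint f g x := 2^-1 * f x + 2^-1 * g x.

(** Linearity is only available for the combinations a * f + g with g in V,
    and f / 2 is such a combination of f with itself. *)
Lemma nabla_half f : V f -> V (fun x => 2^-1 * f x) /\
  {ae mu, forall x, nabla (fun y => 2^-1 * f y) x = 2^-1 *: nabla f x}.
Proof.
move=> Vf.
have -> : (fun x => 2^-1 * f x) = (fun x => - 2^-1 * f x + f x).
  by apply/funext => x; field.
split; first exact: (GS_V_lin GS).
have FF : Filter (almost_everywhere mu) := ae_filter_ringOfSetsType mu.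
apply: (@filterS _ _ FF _ _ _ (GS_nabla_lin GS (- 2^-1) Vf Vf)) => x ->.
by rewrite -[X in _ + X]scale1r -scalerDl; congr (_ *: _); field.
Qed.

Lemma nabla_midpoint f g : V f -> V g -> V (midpoint f g) /\
  vsqnorm (nabla (midpoint f g)) =
  vsqnorm (fun x => 2^-1 *: nabla f x + 2^-1 *: nabla g x).
Proof.
move=> Vf Vg; have [Vg2 ng2] := nabla_half Vg.
have Vm : V (midpoint f g) by exact: (GS_V_lin GS).
split => //; apply: eq_sqnorm_ae => //.
- by apply: measurable_enorm; exact: nabla_measurable.
- by apply: measurable_enorm; apply: coord_measurable_mid; exact: nabla_measurable.
have FF : Filter (almost_everywhere mu) := ae_filter_ringOfSetsType mu.
have nm := GS_nabla_lin GS 2^-1 Vf Vg2.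
by apply: (@filterS2 _ _ FF _ _ _ _ ng2 nm) => x h1 h2 _; rewrite -h1 -h2.
Qed.

Lemma Ggradient_energy_cvg (f_ : nat -> 'rV[R]_n -> R) w : (forall i, V (f_ i)) -> L2vec mu w ->
  vsqnorm (fun x => nabla (f_ i) x - w x)%R @[i --> \oo] --> 0%E ->
  vsqnorm (nabla (f_ i)) @[i --> \oo] --> vsqnorm w.
Proof.
move=> Vf Lw cw; have mw := L2vec_measurable Lw.
have mn i := nabla_measurable (Vf i).
apply: cvg_sqnorm => //.
- by move=> i; exact: measurable_enorm.
- exact: measurable_enorm.
- exact: L2vec_lty.
- exact: enorm_cvg.
Qed.

Lemma GgradientP f w : f \in Lfun mu 2%:E -> Ggradients mu V nabla f w <->
  L2vec mu w /\ exists f_ : nat -> 'rV[R]_n -> R,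
    [/\ forall i, V (f_ i),
        sqnormR (fun x => f_ i x - f x)%R @[i --> \oo] --> 0%E &
        vsqnorm (fun x => nabla (f_ i) x - w x)%R @[i --> \oo] --> 0%E].
Proof.
by move=> Lf; split=> -[Lw [f_ [Vf c1 c2]]]; split=> //; exists f_; split=> //;
  apply/normL2_cvg0.
Qed.

(** The sequence defining the G-gradient competes in the envelope. *)
Lemma envelope_le_Ggradient f w : f \in Lfun mu 2%:E ->
  Ggradients mu V nabla f w -> (E f <= 2^-1%:E * vsqnorm w)%E.
Proof.
move=> Lf [Lw [f_ [Vf fc /normL2_cvg0 wc]]].
have cE : energyG mu V nabla (f_ i) @[i --> \oo] --> (2^-1%:E * vsqnorm w)%E.
  rewrite (_ : (fun i => _) = fun i => (2^-1%:E * vsqnorm (nabla (f_ i)))%E).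
    by apply: cvgeZl => //; exact: Ggradient_energy_cvg.
  by apply/funext => i; exact: energyG_V.
apply: ereal_inf_lbound; exists f_; last exact: (cvg_limn_einf_sup cE).1.
by split => // i; exact: V_Lfun.
Qed.

Lemma wug_Ggradient f w : f \in Lfun mu 2%:E ->
  Ggradients mu V nabla f w -> is_wug mu f (fun x => enorm (w x)).
Proof.
move=> Lf /(GgradientP _ Lf)[Lw [f_ [Vf fc wc]]].
have mw := L2vec_measurable Lw.
apply: (@is_wug_limit _ _ _ _ _ f_ (fun i x => enorm (nabla (f_ i) x))) => //.
- by apply/Lfun2P; split; [exact: measurable_enorm|exact: L2vec_lty].
- by move=> x; exact: enorm_ge0.
- by move=> i x; exact: enorm_ge0.
- by move=> i; exact: (GS_wug GS).
- by apply: enorm_cvg => // i; exact: nabla_measurable.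
Qed.

(** Almost minimizers of the energy near f have convergent gradients, and the
    energy of the limit is bounded by that of any competing sequence: its late
    terms either lie outside V, with infinite energy, or compete with the
    almost minimizers. *)
Lemma exists_Ggradient f : f \in Lfun mu 2%:E -> (E f < +oo)%E ->
  exists2 v, Ggradients mu V nabla f v & (2^-1%:E * vsqnorm v <= E f)%E.
Proof.
move=> Lf Eoo; have /Lfun2P[mf foo] := Lf.
pose C (k : nat) : set ('rV[R]_n -> R) :=
  [set h | V h /\ (sqnormR (fun x => h x - f x)%R <= k.+1%:R^-1%:E)%E].
pose N h := fine (vsqnorm (nabla h)).
pose dist h g := fine (vsqnorm (fun x => nabla h x - nabla g x)%R).
have Vfin h : V h -> vsqnorm (nabla h) \is a fin_num.
  move=> Vh; rewrite ge0_fin_numE ?sqnorm_ge0//.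
  by apply: L2vec_lty; exact: (GS_nabla_L2 GS).
have inC (g_ : nat -> 'rV[R]_n -> R) k : cvgL2 mu g_ f ->
    exists K, forall i, (K <= i)%N -> V (g_ i) -> C k (g_ i).
  move=> /normL2_cvg0 gc; have k0 : 0 < k.+1%:R^-1 :> R by rewrite invr_gt0 ltr0n.
  have [K HK] := (cvg0_eP (fun i => sqnorm_ge0 _ _ _)).1 gc _ k0.
  by exists K => i Ki Vi; split => //; exact: HK.
(* the energies of a sequence with finite lower limit are bounded along a
   subsequence, which meets every [C k] *)
have [B CB] : exists B, forall k, exists2 h, C k h & N h <= B.
  have [_ [g_ [Lg gc] <-] gE] := ereal_inf_lt Eoo.
  have [M gM] : exists M : R, (limn_einf (energyG mu V nabla \o g_) < M%:E)%E.
    case: (limn_einf _) gE => [r||] // _; last by exists 0; rewrite ltNy0.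
    by exists (r + 1); rewrite lte_fin ltrDl.
  exists (2 * M) => k; have [K HK] := inC g_ k gc.
  have [i Ki] := limn_einf_lt_often K gM.
  have [Vi|nVi] := pselect (V (g_ i)); last by rewrite /= energyG_notV.
  rewrite /= energyG_V// => Ei; exists (g_ i); first exact: HK.
  rewrite /N -lee_fin fineK ?Vfin//.
  move: Ei; rewrite -(fineK (Vfin _ Vi)) -EFinM !lte_fin lee_fin => Ei; lra.
have C0V k h : C k h -> V h by case.
have Cmono i j : (i <= j)%N -> C j `<=` C i.
  move=> ij h [Vh hf]; split=> //; apply: (le_trans hf).
  by rewrite lee_fin lef_pV2 ?posrE ?ltr0n// ler_nat ltnS.
have Cmid k g h : C k g -> C k h -> C k (midpoint g h).
  move=> [Vg gf] [Vh hf]; split; first by have [] := nabla_midpoint Vg Vh.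
  have /Lfun2P[mg _] := V_Lfun Vg; have /Lfun2P[mh _] := V_Lfun Vh.
  have := sqnorm_mid mu measurableT (measurable_funB mg mf) (measurable_funB mh mf).
  have <- : sqnormR (fun x => midpoint g h x - f x)%R =
      sqnormR (fun x => 2^-1 * ((g \- f) x + (h \- f) x))%R.
    by apply: eq_sqnorm => x _; rewrite /midpoint/=; congr (_ ^+ 2); field.
  move=> /le_trans; apply.
  rewrite (splitr k.+1%:R^-1) mulrC -mulrDr EFinM lee_pmul2l ?lte_fin ?invr_gt0//.
  by rewrite EFinD leeD.
have [] := @almost_minimizers_cauchy R _ C midpoint N dist B Cmono Cmid _ CB.
- by move=> h _; rewrite fine_ge0// sqnorm_ge0.
- move=> g h /C0V Vg /C0V Vh; have [Vm mE] := nabla_midpoint Vg Vh.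
  have := vsqnorm_parallelogram mu (nabla_measurable Vg) (nabla_measurable Vh).
  rewrite -mE /dist /N; move: (Vfin _ Vg) (Vfin _ Vh) (Vfin _ Vm).
  have := sqnorm_ge0 mu setT (fun x => enorm (nabla g x - nabla h x)).
  rewrite -/(vsqnorm (fun x => nabla g x - nabla h x)).
  move: (vsqnorm (fun x => nabla g x - nabla h x)%R) (vsqnorm (nabla g))
    (vsqnorm (nabla h)) (vsqnorm (nabla (midpoint g h))).
  by move=> [a||] [b||] [c||] [e||]//= _ _ _ _ [<-]; rewrite addrK.
move=> x_ [Cx xmin cauchy].
have Vx k : V (x_ k) by have [] := Cx k.
have [v Lv vc] : exists2 v, L2vec mu v &
    vsqnorm (fun x => nabla (x_ k) x - v x)%R @[k --> \oo] --> 0%E.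
  apply: vsqnorm_complete => [k|e e0]; first exact: (GS_nabla_L2 GS).
  have [K HK] := cauchy e e0; exists K => i j Ki Kj.
  have := HK i j Ki Kj; rewrite /dist -lee_fin fineK//.
  rewrite ge0_fin_numE ?sqnorm_ge0//.
  by apply: L2vec_lty; apply: L2vecB; exact: (GS_nabla_L2 GS).
have xc : sqnormR (fun x => x_ k x - f x)%R @[k --> \oo] --> 0%E.
  apply/cvg0_eP => [k|e e0]; first exact: sqnorm_ge0.
  have [K _ HK] := near_infty_natSinv_lt (PosNum e0).
  exists K => k /HK /= ke; have [_ xk] := Cx k; apply: (le_trans xk).
  by rewrite lee_fin ltW.
have Nc := Ggradient_energy_cvg Vx Lv vc.
exists v; first by apply/(GgradientP _ Lf); split=> //; exists x_.
apply: le_ereal_inf_tmp => _ [g_ [Lg gc] <-].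
have lower k : (2^-1%:E * (vsqnorm (nabla (x_ k)) - (k.+1%:R^-1)%:E) <=
    limn_einf (energyG mu V nabla \o g_))%E.
  have [K HK] := inC g_ k gc; apply: (@limn_einf_ge _ _ _ K) => i Ki /=.
  have [Vi|nVi] := pselect (V (g_ i)); last by rewrite energyG_notV// leey.
  rewrite energyG_V// lee_pmul2l ?lte_fin ?invr_gt0//.
  rewrite -(fineK (Vfin _ Vi)) -(fineK (Vfin _ (Vx k))) lee_fin lerBlDr.
  exact: xmin (HK _ Ki Vi).
have invc : (k.+1%:R^-1 : R)%:E @[k --> \oo] --> 0%E.
  by apply: cvg_EFin; [exact: nearW|exact: cvg_harmonic].
have Lc : (2^-1%:E * (vsqnorm (nabla (x_ k)) - (k.+1%:R^-1)%:E))%E @[k --> \oo] -->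
    (2^-1%:E * vsqnorm v)%E.
  apply: cvgeZl => //; rewrite -[X in _ --> X]sube0.
  apply: (@cvgeB _ _ _ _ (fun k => vsqnorm (nabla (x_ k)))
    (fun k => (k.+1%:R^-1)%:E)) => //.
  by apply: fin_num_adde_defr; rewrite ge0_fin_numE ?sqnorm_ge0// L2vec_lty.
by apply: (cvge_to_le Lc); exact: nearW.
Qed.

End Gstructure.

(** * The Cheeger energy and the minimal G-gradient *)
Section main.
Context (R : realType) (n : nat).
Variable mu : {measure set (borelRn R n) -> \bar R}.
Local Notation sqnormR := (@sqnorm _ (borelRn R n) R mu setT).

Lemma normL2_le (f g : 'rV[R]_n -> R) :
  (normL2 mu f <= normL2 mu g)%E <-> (sqnormR f <= sqnormR g)%E.
Proof.
have E (h : 'rV[R]_n -> R) : (normL2 mu h `^ 2 = sqnormR h)%E.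
  by rewrite normL2E -poweRrM mulVf// poweRe1// sqnorm_ge0.
have n0 (h : 'rV[R]_n -> R) : (0 <= normL2 mu h)%E by exact: Lnorm_ge0.
split => H; first rewrite -(E f) -(E g).
  by rewrite gt0_ler_poweR// ?in_itv/= ?leey ?n0.
by rewrite !normL2E gt0_ler_poweR// ?in_itv/= ?leey ?sqnorm_ge0.
Qed.

Lemma cheegerE f G : W12 mu f -> is_min_wug mu f G ->
  cheeger mu f = (2^-1%:E * sqnormR G)%E.
Proof.
move=> Wf Gmin; rewrite /cheeger asboolT//; congr (_ * _)%E.
have /= Hmin : [set H | is_min_wug mu f H] (min_wug mu f) by exact: (xgetI _ Gmin).
have [wG lG] := Gmin; have [wH lH] := Hmin.
have [_ /Lfun2P[mG _] _ _] := wG; have [_ /Lfun2P[mH _] _ _] := wH.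
have FF : Filter (almost_everywhere mu) := ae_filter_ringOfSetsType mu.
apply: eq_sqnorm_ae => //.
apply: (@filterS2 _ _ FF _ _ _ _ (lG _ wH) (lH _ wG)) => x GH HG _.
by apply/eqP; rewrite eq_le HG.
Qed.

(** [min_wug f] then takes its default value 0. *)
Lemma cheeger_no_min f : W12 mu f -> ~ (exists G, is_min_wug mu f G) ->
  cheeger mu f = 0%E.
Proof.
move=> Wf nG; rewrite /cheeger asboolT// /min_wug xgetPN; last first.
  by move=> G Gmin; apply: nG; exists G.
by rewrite (eq_integral (cst 0%E)) ?integral0 ?mule0// => x _; rewrite expr0n.
Qed.

Lemma cheeger_lty f : W12 mu f -> (cheeger mu f < +oo)%E.
Proof.
move=> Wf; have [[G Gmin]|nG] := pselect (exists G, is_min_wug mu f G).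
  rewrite (cheegerE Wf Gmin); have [[_ /Lfun2P[_ Goo] _ _] _] := Gmin.
  by rewrite lte_mul_pinfty// lee_fin invr_ge0.
by rewrite cheeger_no_min// ltry.
Qed.

End main.

Theorem theorem2p14 (R : realType) (n : nat)
    (mu : {measure set (borelRn R n) -> \bar R})
    (V : set ('rV[R]_n -> R))
    (nabla : ('rV[R]_n -> R) -> 'rV[R]_n -> 'rV[R]_n) :
  radon mu ->
  G_structure mu V nabla ->
  W12 mu = [set f : 'rV[R]_n -> R |
              f \in Lfun mu 2%:E /\ Ggradients mu V nabla f !=set0] /\
  (forall f, W12 mu f ->
     [/\ exists G, is_min_wug mu f G,
         exists v, is_min_Ggradient mu V nabla f v &
         forall G v, is_min_wug mu f G -> is_min_Ggradient mu V nabla f v ->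
           {ae mu, forall x, G x = enorm (v x)}]).
Proof.
move=> _ GS.
have recover f : W12 mu f -> exists2 v, Ggradients mu V nabla f v &
    (2^-1%:E * vsqnorm mu v <= cheeger mu f)%E.
  move=> Wf; have [Lf _] := Wf; rewrite (GS_envelope GS Lf).
  apply: (exists_Ggradient GS Lf); rewrite -(GS_envelope GS Lf).
  exact: cheeger_lty.
split.
  apply/seteqP; split => f /=.
    by move=> Wf; have [Lf _] := Wf; split => //; have [v vf _] := recover f Wf; exists v.
  move=> [Lf [v vf]]; split => //; exists (fun x => enorm (v x)).
  exact: (wug_Ggradient GS Lf vf).
move=> f Wf; have [Lf _] := Wf; have [v0 v0f v0E] := recover f Wf.
have FF : Filter (almost_everywhere mu) := ae_filter_ringOfSetsType mu.
have mv v : Ggradients mu V nabla f v -> coord_measurable v.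
  by move=> [Lv _]; exact: L2vec_measurable Lv.
split.
- have [//|nG] := pselect (exists G, is_min_wug mu f G).
  exists (fun x => enorm (v0 x)); split; first exact: (wug_Ggradient GS Lf v0f).
  have v00 : vsqnorm mu v0 = 0%E.
    move: v0E; rewrite cheeger_no_min// pmule_rle0 ?lte_fin ?invr_gt0// => v0E.
    by apply/eqP; rewrite eq_le v0E sqnorm_ge0.
  move=> H [_ _ H0 _].
  have ev0 := sqnorm_eq0_ae measurableT (measurable_enorm (mv _ v0f)) v00.
  by apply: (@filterS2 _ _ FF _ _ _ _ ev0 H0) => x /(_ I) ->.
- exists v0; split => // w wf; apply/normL2_le.
  have := envelope_le_Ggradient GS Lf wf; rewrite -(GS_envelope GS Lf).
  by move=> /(le_trans v0E); rewrite lee_pmul2l// lte_fin invr_gt0.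
move=> G v Gmin [vf vmin].
have [wG lG] := Gmin; have [_ /Lfun2P[mG Goo] G0 _] := wG.
have Gv := lG _ (wug_Ggradient GS Lf vf).
have vG : (vsqnorm mu v <= @sqnorm _ (borelRn R n) R mu setT G)%E.
  apply: (@le_trans _ _ (vsqnorm mu v0)).
    by apply/normL2_le; exact: vmin.
  by move: v0E; rewrite (cheegerE Wf Gmin) lee_pmul2l// lte_fin invr_gt0.
have := @le_sqnorm_eq_ae _ (borelRn R n) R mu setT measurableT _ _ mG
  (measurable_enorm (mv _ vf)) Goo.
move=> H; have := H (@filterS _ _ FF _ _ (fun x Gx _ => Gx) G0)
  (@filterS _ _ FF _ _ (fun x Gx _ => Gx) Gv) vG.
by apply: (@filterS _ _ FF) => x; exact.
Qed.
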